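(* Let $A$ be a self-adjoint operator on an infinite-dimensional Hilbert space $\mathcal{H}$, $B$ a bounded symmetric operator on $\mathcal{H}$, $\gamma\in\rho(A)\cap\mathbb{R}$, $\lVert B\rVert\le\operatorname{dist}(\gamma,\sigma(A))/2$, $\kappa\in\mathbb{R}$, $E>\gamma$, and assume $$\forall x\in\operatorname{Ran}P_{A+B}(E):\quad\langle x,Bx\rangle\ge\kappa\lVert x\rVert^2.$$ Then for all $k\in\mathbb{N}\cup\{\infty\}$ with $\lambda^{\rightarrow}_{k,\gamma}(A+B)<E$ we have $$\lambda^{\rightarrow}_{k,\gamma}(A+B)\ \ge\ \lambda^{\rightarrow}_{k,\gamma}(A)+\kappa.$$
   Context: $P_A(E)=\mathbf{1}_{(-\infty,E]}(A)$ is the spectral projection of a self-adjoint operator $A$. $A$ need not be semi-bounded. For $\gamma\in\rho(A)\cap\mathbb{R}$ set $\lambda^{\rightarrow}_{\infty,\gamma}(A)=\inf\{\lambda>\gamma:\lambda\in\sigma_{\mathrm{ess}}(A)\}$ ($=\infty$ if there is no essential spectrum above $\gamma$). $(\lambda^{\rightarrow}_{k,\gamma}(A))_{k\in\mathbb{N}}$ denotes the eigenvalues of $A$ in $(\gamma,\lambda^{\rightarrow}_{\infty,\gamma}(A))$, enumerated non-decreasingly and counting multiplicities; if there are exactly $N\in\mathbb{N}_0$ of them, one sets $\lambda^{\rightarrow}_{k,\gamma}(A)=\lambda^{\rightarrow}_{\infty,\gamma}(A)$ for all $k>N$. *)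

(* Defs.v *)
From HB Require Import structures.
From mathcomp Require Import all_boot all_order all_algebra.
From mathcomp Require Import sesquilinear complex.
From mathcomp Require Import all_classical all_reals all_analysis.

Set Implicit Arguments.
Unset Strict Implicit.
Unset Printing Implicit Defensive.

Import Order.TTheory GRing.Theory Num.Theory.
Import numFieldNormedType.Exports.

Local Open Scope classical_set_scope.
Local Open Scope ring_scope.
Local Open Scope complex_scope.

Section Dimension.
Variables (K : fieldType) (V : lmodType K).

Definition lin_indep (n : nat) (v : 'I_n -> V) : Prop :=
  forall c : 'I_n -> K, \sum_(i < n) c i *: v i = 0 -> forall i, c i = 0.

Definition lin_span (n : nat) (v : 'I_n -> V) : set V :=
  [set x | exists c : 'I_n -> K, x = \sum_(i < n) c i *: v i].

Definition has_dim (W : set V) (n : nat) : Prop :=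
  exists v : 'I_n -> V, lin_indep v /\ W = lin_span v.

Definition infinite_dimensional : Prop := forall n, ~ has_dim setT n.

End Dimension.

(* The norm of a normed module over [R[i]] is [R[i]]-valued, hence [Re]. *)
Definition rnorm (R : realType) (H : normedModType R[i]) (x : H) : R :=
  complex.Re `|x|.

(* Only the values of [op] on [dom] matter. *)
Record operator (H : Type) := Operator { dom : set H; op :> H -> H }.

Section Operators.
Variables (R : realType) (H : completeNormedModType R[i]).
(* In a form [{dot H for Num.conj}] the first argument is the linear one. *)
Variable ip : {dot H for Num.conj}.
Implicit Types (A : operator H) (B : {linear H -> H}).

Definition linear_operator A : Prop :=
  dom A 0 /\
  forall (a : R[i]) x y, dom A x -> dom A y ->
    dom A (a *: x + y) /\ A (a *: x + y) = a *: A x + A y.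

(* The pair [(y, z)] belongs to the graph of the adjoint of [A]. *)
Definition adjoint_graph A (y z : H) : Prop :=
  forall x, dom A x -> ip (A x) y = ip x z.

Definition self_adjoint A : Prop :=
  [/\ linear_operator A, dense (dom A) &
      forall y z, adjoint_graph A y z <-> dom A y /\ A y = z].

Definition symmetric_op (B : H -> H) : Prop :=
  forall x y, ip (B x) y = ip x (B y).

Definition bounded_op B : Prop :=
  exists M : R, forall x, rnorm (B x) <= M * rnorm x.

Definition opnorm B : \bar R :=
  ereal_sup [set (rnorm (B x))%:E | x in [set x | rnorm x <= 1]].

Definition add_bounded A B : operator H :=
  Operator (dom A) (fun x => A x + B x).

Definition resolvent_set A : set R[i] :=
  [set z | [/\ set_inj (dom A) (fun x => A x - z *: x),
               [set A x - z *: x | x in dom A] = setT &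
               exists M : R, forall x, dom A x ->
                 rnorm x <= M * rnorm (A x - z *: x)]].

Definition spectrum A : set R[i] := ~` resolvent_set A.

Definition eigenspace_op A (z : R[i]) : set H :=
  [set x | dom A x /\ A x = z *: x].

(* Isolated points of the spectrum that are eigenvalues of finite
   multiplicity. *)
Definition discrete_spectrum A : set R[i] :=
  [set z | [/\ spectrum A z,
               exists2 e : R, 0 < e &
                 forall w, spectrum A w -> `|w - z| < e%:C -> w = z &
               exists n : nat, (0 < n)%N /\ has_dim (eigenspace_op A z) n]].

Definition essential_spectrum A : set R[i] :=
  spectrum A `\` discrete_spectrum A.

Definition dist_to (z : R[i]) (S : set R[i]) : \bar R :=
  ereal_inf [set (complex.Re `|z - w|)%:E | w in S].

Definition lambda_inf A (gamma : R) : \bar R :=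
  ereal_inf [set l%:E | l in [set l : R | gamma < l /\
                                          essential_spectrum A l%:C]].

(* [l] enumerates the eigenvalues of [A] in the interval from [gamma] to
   [lambda_inf A gamma], non-decreasingly and with multiplicities, and is
   continued by [lambda_inf A gamma] if there are only finitely many of them.
   Indices start at 0, so [l k] is the eigenvalue number [k.+1]. *)
Definition eigenvalue_enumeration A (gamma : R) (l : nat -> \bar R) : Prop :=
  [/\ forall i j, (i <= j)%N -> (l i <= l j)%E,
      forall k, l k = lambda_inf A gamma \/
        exists t : R, [/\ gamma < t, (t%:E < lambda_inf A gamma)%E,
          exists x, x != 0 /\ eigenspace_op A t%:C x & l k = t%:E] &
      forall t : R, gamma < t -> (t%:E < lambda_inf A gamma)%E ->
        exists n : nat, has_dim (eigenspace_op A t%:C) n /\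
                        ([set k | l k = t%:E] #= `I_n)%card].

Definition orthogonal_projection (P : {linear H -> H}) : Prop :=
  (forall x, P (P x) = P x) /\ symmetric_op P.

(* [mu] is the Borel measure [S |-> <Q S x, x>]. *)
Definition scalar_measure (Q : set R -> {linear H -> H}) (x : H)
    (mu : {measure set (measurableTypeR R) -> \bar R}) : Prop :=
  forall S : set R, measurable S -> mu S = (complex.Re (ip (Q S x) x))%:E.

Definition projection_valued_measure (Q : set R -> {linear H -> H}) : Prop :=
  [/\ forall S, measurable S -> orthogonal_projection (Q S),
      forall x, Q setT x = x &
      forall x, exists mu, scalar_measure Q x mu].

(* [Q] is the projection-valued measure with [A = \int t dQ(t)], so that
   [Q S] is the operator [1_S(A)]; for self-adjoint [A] it exists and is
   unique on Borel sets by the spectral theorem. *)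
Definition spectral_measure A (Q : set R -> {linear H -> H}) : Prop :=
  projection_valued_measure Q /\
  forall x mu, scalar_measure Q x mu ->
    (dom A x <-> (\int[mu]_t ((t ^+ 2)%:E) < +oo)%E) /\
    (dom A x -> ip (A x) x = (\int[mu]_t t)%R%:C).

End Operators.

(* Main.v *)
Require Import Defs.
From HB Require Import structures.
From mathcomp Require Import all_boot all_order all_algebra.
From mathcomp Require Import sesquilinear complex.
From mathcomp Require Import all_classical all_reals all_analysis.
From mathcomp Require Import measurable_realfun ring lra.

Set Implicit Arguments.
Unset Strict Implicit.
Unset Printing Implicit Defensive.

Import Order.TTheory GRing.Theory Num.Theory.
Import numFieldNormedType.Exports.

Local Open Scope classical_set_scope.
Local Open Scope ring_scope.
Local Open Scope complex_scope.

(** The classical max-min description of the eigenvalues above gamma cannot be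
    applied directly, because A is unbounded below and the spectral projections
    of A and M := A + B below gamma differ.  Instead fix the projection P of M
    onto (-oo, gamma].  Since |B| <= dist(gamma, sigma(A)) / 2, the diagonal
    blocks of A with respect to P satisfy A <= gamma on ran P and A >= gamma on
    ker P.  Suppose that the k-th eigenvalue of A exceeds some mu with
    lambda_k(M) - kappa < mu.  A (k+1)-dimensional subspace of
    ran 1_(gamma, lambda](M), with lambda close to lambda_k(M), is lifted by a
    Schur complement to vectors x such that (A - mu) x is orthogonal to ran P;
    the hypothesis on B makes <(A - mu) x, x> negative.  Some such x <> 0 is
    orthogonal to the at most k eigenvectors of A in (gamma, mu).  On their
    orthogonal complement A has no spectrum between gamma and mu, so that
    <(A - gamma) z, (A - mu) z> >= 0, and comparing
    (A - gamma)^-1 with (A - mu)^-1 at u = (A - mu) x gives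
    <(A - gamma)^-1 u, u> < 0.  But u is in ker P, and the signs of the
    diagonal blocks of A - gamma make this number nonnegative. *)

(** * The real part of the inner product *)

(** Only [A + B] comes with a spectral measure. What is needed about [A] (gaps, isolated spectral
    points, distance to the spectrum) is extracted from lower bounds |(A - t) x| >= c |x| by
    variational arguments, with no functional calculus for [A]. The lift answers the lack of a lower
    bound for A: a trial space would have to contain ran P, possibly infinite-dimensional, and no
    count of orthogonality conditions copes with that. Making (A - mu) x orthogonal to ran P removes
    these directions, while the correction stays in ran P, so that x remains in the range of the
    projection onto (-oo, lambda]. With lambda <= E this is where the hypothesis on B applies. The
    factor 1/2 is spent twice: half of the distance keeps a gap of A + B around gamma, and that gap
    absorbs B when one returns from the blocks of A + B to those of A. If the k-th value of A + B is
    the bottom of its essential spectrum, eigenvectors may be missing; the k + 1 vectors then come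
    from spectral subspaces reaching just above it. *)

Section RealInnerProduct.
Variables (R : realType) (H : completeNormedModType R[i]).
Variable ip : {dot H for Num.conj}.
Hypothesis ip_norm : forall x : H, ip x x = `|x| ^+ 2.
Implicit Types (x y z : H) (r : R).

Lemma ipDl x y z : ip (x + y) z = ip x z + ip y z.
Proof. exact: linearDl. Qed.

Lemma ipDr x y z : ip z (x + y) = ip z x + ip z y.
Proof. exact: linearDr. Qed.

Lemma ipNl x y : ip (- x) y = - ip x y.
Proof. exact: linearNl. Qed.

Lemma ipNr x y : ip x (- y) = - ip x y.
Proof. exact: linearNr. Qed.

Lemma ipZl (a : R[i]) x y : ip (a *: x) y = a * ip x y.
Proof. exact: linearZl_LR. Qed.

Lemma ipZr (a : R[i]) x y : ip x (a *: y) = a^*%C * ip x y.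
Proof. exact: linearZr_LR. Qed.

(** Taking real parts gives a symmetric bilinear form over [R], so that [ring], [lra] and [nra]
    apply; complex information is recovered by inserting ['i] (see [rip_i]). *)
Definition realip x y : R := complex.Re (ip x y).
Local Notation rip := realip.

Lemma ripDl x y z : rip (x + y) z = rip x z + rip y z.
Proof. by rewrite /realip linearDl raddfD. Qed.

Lemma ripDr x y z : rip z (x + y) = rip z x + rip z y.
Proof. by rewrite /realip linearDr raddfD. Qed.

Lemma ripNl x y : rip (- x) y = - rip x y.
Proof. by rewrite /realip linearNl raddfN. Qed.

Lemma ripNr x y : rip x (- y) = - rip x y.
Proof. by rewrite /realip linearNr raddfN. Qed.

Lemma ipC x y : ip x y = (ip y x)^*%C.
Proof. by rewrite hermC expr0 mul1r. Qed.

Lemma ripC x y : rip x y = rip y x.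
Proof. by rewrite /realip ipC; case: (ip y x). Qed.

Lemma ripZl r x y : rip (r%:C *: x) y = r * rip x y.
Proof. by rewrite /realip linearZl_LR /=; case: (ip x y) => a b /=; ring. Qed.

Lemma ripZr r x y : rip x (r%:C *: y) = r * rip x y.
Proof. by rewrite ripC ripZl ripC. Qed.

Definition ripE := (ripDl, ripDr, ripNl, ripNr, ripZl, ripZr).

Lemma rip0l x : rip 0 x = 0.
Proof. by rewrite -(subrr x) !ripE subrr. Qed.

Lemma rip0r x : rip x 0 = 0.
Proof. by rewrite ripC rip0l. Qed.

Lemma rip_i x y : rip x ('i *: y) = complex.Im (ip x y).
Proof. by rewrite /realip linearZr_LR /=; case: (ip x y) => a b /=; ring. Qed.

Lemma normE x : `|x| = (rnorm x)%:C.
Proof.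
rewrite /rnorm; have : 0 <= `|x| by [].
by case: (`|x|) => a b; rewrite lecE /= => /andP[/eqP -> _].
Qed.

Lemma rnorm_ge0 x : 0 <= rnorm x.
Proof. by rewrite -lecR -normE normr_ge0. Qed.

Lemma rnorm_eq0 x : rnorm x = 0 -> x = 0.
Proof. by move=> h; apply/eqP; rewrite -normr_eq0 normE h. Qed.

Lemma rnormD x y : rnorm (x + y) <= rnorm x + rnorm y.
Proof. by rewrite -lecR raddfD /= -!normE ler_normD. Qed.

Lemma rnormN x : rnorm (- x) = rnorm x.
Proof. by rewrite /rnorm normrN. Qed.

Lemma rnormB x y : rnorm (x - y) = rnorm (y - x).
Proof. by rewrite /rnorm distrC. Qed.

Lemma rnorm0 : rnorm (0 : H) = 0.
Proof. by rewrite /rnorm normr0. Qed.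

Lemma rnorm_gt0 x : x != 0 -> 0 < rnorm x.
Proof.
move=> x0; rewrite lt0r rnorm_ge0 andbT; apply: contra x0 => /eqP.
by move/rnorm_eq0 ->.
Qed.

Lemma rnormZ (a : R[i]) x : rnorm (a *: x) = complex.Re `|a| * rnorm x.
Proof.
rewrite /rnorm normrZ (normE x).
by have : 0 <= `|a| by []; case: (`|a|) => u v; rewrite lecE /= => /andP[/eqP -> _]; ring.
Qed.

Lemma rnormZR r x : rnorm (r%:C *: x) = `|r| * rnorm x.
Proof. by rewrite rnormZ normc_def /= expr0n addr0 sqrtr_sqr. Qed.

Lemma ripxx x : rip x x = rnorm x ^+ 2.
Proof.
by rewrite /realip ip_norm normE -rmorphXn.
Qed.

Lemma rip_ge0 x : 0 <= rip x x.
Proof. by rewrite ripxx sqr_ge0. Qed.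

Lemma rip_eq0 x : rip x x = 0 -> x = 0.
Proof.
by rewrite ripxx => /eqP; rewrite sqrf_eq0 => /eqP; exact: rnorm_eq0.
Qed.

Lemma rip_gt0 x : x != 0 -> 0 < rip x x.
Proof. by move=> x0; rewrite ripxx exprn_gt0 ?rnorm_gt0. Qed.

Lemma discriminant_le (a b c : R) : 0 <= c ->
  (forall t : R, 0 <= a + 2 * t * b + t ^+ 2 * c) -> b ^+ 2 <= a * c.
Proof.
move=> c0 h; have [c00|cn0] := eqVneq c 0.
  have [->|b0] := eqVneq b 0; first by rewrite c00 mulr0 expr0n.
  (* For c = 0 the quadratic is affine in t; this t gives it the value -1. *)
  have := h (- (a + 1) / b * 2^-1); rewrite c00.
  have -> : a + 2 * (- (a + 1) / b * 2^-1) * b + (- (a + 1) / b * 2^-1) ^+ 2 * 0 = - 1 by field.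
  lra.
have := h (- b / c).
have -> : a + 2 * (- b / c) * b + (- b / c) ^+ 2 * c = (a * c - b ^+ 2) / c by field.
by rewrite pmulr_lge0 ?invr_gt0 ?lt0r ?cn0 // subr_ge0.
Qed.

(** Testing against every z reduces vector identities to scalar ones that [ring] settles; most later
    uses are of this kind. *)
Lemma rip_inj x y : (forall z, rip x z = rip y z) -> x = y.
Proof.
move=> h; apply/eqP; rewrite -subr_eq0; apply/eqP/rip_eq0.
by rewrite ripDl ripNl h subrr.
Qed.

Lemma ip_inj x y : (forall z, ip x z = ip y z) -> x = y.
Proof. by move=> h; apply: rip_inj => z; rewrite /realip h. Qed.

Lemma rip_CS x y : rip x y ^+ 2 <= rip x x * rip y y.
Proof.
apply: discriminant_le => [|t]; first exact: rip_ge0.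
by have := rip_ge0 (x + t%:C *: y); rewrite !ripE (ripC y x); nra.
Qed.

Lemma rip_le_norm x y : `|rip x y| <= rnorm x * rnorm y.
Proof.
rewrite -(@ler_pXn2r _ 2) ?nnegrE ?mulr_ge0 ?rnorm_ge0 //.
by rewrite real_normK ?num_real // exprMn -!ripxx rip_CS.
Qed.

Lemma rip_le x y : rip x y <= rnorm x * rnorm y.
Proof. exact: le_trans (ler_norm _) (rip_le_norm _ _). Qed.

Lemma complete_seq (u : nat -> H) :
  (forall e : R, 0 < e -> exists N, forall m n, (N <= m)%N -> (N <= n)%N ->
     rnorm (u m - u n) < e) ->
  exists l, forall e : R, 0 < e -> exists N, forall n, (N <= n)%N -> rnorm (u n - l) < e.
Proof.
move=> hC.
have : cvg (u @ \oo).
  apply/cauchy_cvgP/cauchy_ballP => e e0.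
  have e0' : 0 < complex.Re e by move: e0; rewrite ltcE => /andP[].
  have [N hN] := hC _ e0'.
  exists (u @` [set k | N <= k]%N, u @` [set k | N <= k]%N) => /=.
    by split; exists N => // k /= Nk; exists k.
  case=> _ _ [/= [m Nm <-] [n Nn <-]].
  move: e0; rewrite ltcE /= => /andP[/eqP eI _].
  rewrite -ball_normE /ball_ /= normE ltcE /= eI eqxx /=.
  exact: hN.
move=> /cvg_ex[l ul]; exists l => e e0.
have /cvgrPdist_lt/(_ (e%:C)) := ul.
rewrite ltcR => /(_ e0) [N _ hN]; exists N => n Nn.
by have := hN n Nn; rewrite /= normE ltcR rnormB.
Qed.

End RealInnerProduct.

Lemma inv_succ_lt (R : realType) (e : R) : 0 < e ->
  exists N, forall n, (N <= n)%N -> n.+1%:R^-1 < e.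
Proof.
move=> e0; exists (Num.trunc e^-1) => n Nn.
rewrite invf_plt ?posrE //; apply: lt_le_trans (truncnS_gt _) _.
by rewrite ler_nat.
Qed.

(** * Orthogonal decomposition along a subspace that need not be closed *)

Section Projection.
Variables (R : realType) (H : completeNormedModType R[i]).
Variable ip : {dot H for Num.conj}.
Hypothesis ip_norm : forall x : H, ip x x = `|x| ^+ 2.
Implicit Types (x y z : H) (r : R) (C : set H).

Local Notation rip := (realip ip).

Definition real_subspace C : Prop :=
  C 0 /\ forall r x y, C x -> C y -> C (r%:C *: x + y).

Lemma rnorm_lt x (e : R) : 0 < e -> rip x x < e ^+ 2 -> rnorm x < e.
Proof.
by move=> e0; rewrite (ripxx ip_norm) ltr_pXn2r ?nnegrE ?rnorm_ge0 // ltW.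
Qed.

Lemma parallelogram x y :
  rip (x - y) (x - y) = 2 * rip x x + 2 * rip y y - rip (x + y) (x + y).
Proof. by rewrite !ripE (ripC _ y x); ring. Qed.

(* p is the limit of a minimizing sequence for the distance of x to C, which
   is Cauchy by the parallelogram identity. *)
Lemma orth_decomposition C x : real_subspace C ->
  exists p, (forall e : R, 0 < e -> exists2 c, C c & rnorm (p - c) < e) /\
            forall c, C c -> rip c (x - p) = 0.
Proof.
move=> [C0 CD].
pose S := [set rip (x - c) (x - c) | c in C].
have Sinf : has_inf S.
  split; first by exists (rip (x - 0) (x - 0)); exists 0.
  by exists 0 => _ [c _ <-]; exact: rip_ge0.
have dle c : C c -> inf S <= rip (x - c) (x - c).
  by move=> Cc; apply: ge_inf; [exact: Sinf.2|exists c].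
have near_inf n : exists c, C c /\ rip (x - c) (x - c) < inf S + n.+1%:R^-1.
  have n0 : 0 < (n.+1%:R^-1 : R) by rewrite invr_gt0.
  by have [_ [c Cc <-] lt_c] := inf_adherent n0 Sinf; exists c.
have [u hu] := choice near_inf.
have uC n : C (u n) by case: (hu n).
have u_lt n : rip (x - u n) (x - u n) < inf S + n.+1%:R^-1 by case: (hu n).
have [p up] : exists p, forall e : R, 0 < e ->
    exists N, forall n, (N <= n)%N -> rnorm (u n - p) < e.
  apply: complete_seq => e e0.
  have e4 : (0 : R) < e ^+ 2 / 4 by rewrite divr_gt0 ?exprn_gt0.
  have [N hN] := inv_succ_lt e4; exists N => m n Nm Nn.
  apply: rnorm_lt => //.
  have -> : u m - u n = (x - u n) - (x - u m).
    by apply: (rip_inj ip_norm) => z; rewrite !ripE; ring.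
  (* The midpoint of u n and u m lies in C, so its distance to x bounds |(x - u n) + (x - u m)| from
     below in the parallelogram identity. *)
  have mid : C ((2^-1)%:C *: u n + (2^-1)%:C *: u m).
    by apply: (CD _ _ _ (uC n)); rewrite -[X in C X]addr0; apply: CD.
  rewrite parallelogram.
  have := dle _ mid.
  have -> : x - ((2^-1)%:C *: u n + (2^-1)%:C *: u m) =
            (2^-1)%:C *: ((x - u n) + (x - u m)).
    by apply: (rip_inj ip_norm) => z; rewrite !ripE; field.
  have := u_lt m; have := u_lt n; have := hN _ Nm; have := hN _ Nn.
  rewrite ripZl ripZr; move: (n.+1%:R^-1) (m.+1%:R^-1) => a b; lra.
exists p; split=> [e e0|c Cc].
  have [N hN] := up _ e0; exists (u N); first exact: uC.
  by rewrite rnormB; exact: hN.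
(* First variation at an almost minimal point: |x - u n + t c|^2 >= inf S for all t leaves a
   quadratic in t with constant term below 1/(n+1). *)
have small n : rip c (x - u n) ^+ 2 <= n.+1%:R^-1 * rip c c.
  apply: discriminant_le => [|t]; first exact: rip_ge0.
  have := dle _ (CD (- t) _ _ Cc (uC n)); have := u_lt n.
  have -> : x - ((- t)%:C *: c + u n) = (x - u n) + t%:C *: c.
    by apply: (rip_inj ip_norm) => z; rewrite !ripE; ring.
  rewrite (ripDl _ (x - u n)) 2!(ripDr _ (x - u n)) !(ripZl, ripZr) (ripC _ (x - u n) c).
  by move: (n.+1%:R^-1) => a; lra.
apply/eqP/negPn/negP; rewrite -normr_gt0 => r0.
set r := `|_| in r0.
have k0 := rnorm_ge0 c.
have e0 : 0 < r / (2 * (rnorm c + 1)) by rewrite divr_gt0 // mulr_gt0 //; lra.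
have [N1 hN1] := up _ e0.
have e1 : 0 < (r / (2 * (rnorm c + 1))) ^+ 2 by rewrite exprn_gt0.
have [N2 hN2] := inv_succ_lt e1.
pose n := maxn N1 N2.
have h1 : rnorm (u n - p) < r / (2 * (rnorm c + 1)) by apply: hN1; exact: leq_maxl.
have h2 := hN2 n (leq_maxr _ _).
have h3 : `|rip c (x - u n)| <= r / (2 * (rnorm c + 1)) * rnorm c.
  rewrite -(@ler_pXn2r _ 2) ?nnegrE ?(mulr_ge0 (ltW e0)) //.
  rewrite real_normK ?num_real // exprMn -(ripxx ip_norm).
  by apply: le_trans (small n) _; rewrite ler_wpM2r ?(ltW h2) // rip_ge0.
have h4 : `|rip c (u n - p)| <= rnorm c * (r / (2 * (rnorm c + 1))).
  by apply: le_trans (rip_le_norm ip_norm _ _) _; rewrite ler_wpM2l // ltW.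
have : r <= `|rip c (x - u n)| + `|rip c (u n - p)|.
  apply: le_trans (ler_normD _ _).
  by rewrite -ripDr addrA subrK.
have : rnorm c * (r / (2 * (rnorm c + 1))) = r / 2 - r / (2 * (rnorm c + 1)).
  by field; lra.
by move: h3 h4 e0; lra.
Qed.

End Projection.

Lemma eps_le (R : realType) (a b k : R) :
  (forall e, 0 < e -> a <= b + k * e) -> a <= b.
Proof.
move=> h; rewrite leNgt; apply/negP => ba.
have k0 : 0 < `|k| + 1 by have := normr_ge0 k; lra.
have e0 : 0 < (a - b) / (2 * (`|k| + 1)).
  by rewrite divr_gt0 ?subr_gt0 // mulr_gt0.
have := h _ e0.
have : k * ((a - b) / (2 * (`|k| + 1))) <= `|k| * ((a - b) / (2 * (`|k| + 1))).
  by rewrite ler_wpM2r ?(ltW e0) // ler_norm.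
have : `|k| * ((a - b) / (2 * (`|k| + 1))) =
       (a - b) / 2 - (a - b) / (2 * (`|k| + 1)).
  by field; lra.
by move: ba e0; lra.
Qed.

Lemma eps_eq0 (R : realType) (r k : R) :
  (forall e, 0 < e -> `|r| <= k * e) -> r = 0.
Proof.
move=> h; apply/eqP; rewrite -normr_le0; apply: (@eps_le _ _ _ k) => e /h.
by rewrite add0r.
Qed.

(** * Self-adjoint operators *)

Section SelfAdjoint.
Variables (R : realType) (H : completeNormedModType R[i]).
Variable ip : {dot H for Num.conj}.
Hypothesis ip_norm : forall x : H, ip x x = `|x| ^+ 2.
Implicit Types (x y z : H) (r : R) (C : set H).

Local Notation rip := (realip ip).

Lemma ripZC (a : R[i]) x y : rip (a *: x) y = rip x (a^*%C *: y).
Proof.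
rewrite /realip linearZl_LR linearZr_LR /=.
by case: a (ip x y) => a b [c d] /=; ring.
Qed.

Section Linear.
Variable A : operator H.
Hypothesis A_lin : linear_operator A.

Lemma dom0 : dom A 0. Proof. by case: A_lin. Qed.

Lemma domP (a : R[i]) x y : dom A x -> dom A y -> dom A (a *: x + y).
Proof. by case: A_lin => _ h dx dy; case: (h a x y dx dy). Qed.

Lemma opP (a : R[i]) x y : dom A x -> dom A y -> A (a *: x + y) = a *: A x + A y.
Proof. by case: A_lin => _ h dx dy; case: (h a x y dx dy). Qed.

Lemma op0 : A 0 = 0.
Proof.
have := opP 1 dom0 dom0; rewrite !scale1r addr0 => /esym h.
by apply: (addrI (A 0)); rewrite h addr0.
Qed.

Lemma domD x y : dom A x -> dom A y -> dom A (x + y).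
Proof. by rewrite -[x in dom A (x + _)]scale1r; exact: domP. Qed.

Lemma opD x y : dom A x -> dom A y -> A (x + y) = A x + A y.
Proof. by move=> dx dy; rewrite -[x in LHS]scale1r opP // scale1r. Qed.

Lemma domZ (a : R[i]) x : dom A x -> dom A (a *: x).
Proof. by move=> dx; rewrite -[a *: x]addr0; apply: domP => //; exact: dom0. Qed.

Lemma opZ (a : R[i]) x : dom A x -> A (a *: x) = a *: A x.
Proof. by move=> dx; rewrite -[a *: x]addr0 opP ?op0 ?addr0 //; exact: dom0. Qed.

Lemma domN x : dom A x -> dom A (- x).
Proof. by rewrite -scaleN1r; exact: domZ. Qed.

Lemma opN x : dom A x -> A (- x) = - A x.
Proof. by move=> dx; rewrite -scaleN1r opZ // scaleN1r. Qed.

Lemma domB x y : dom A x -> dom A y -> dom A (x - y).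
Proof. by move=> dx dy; apply: domD => //; exact: domN. Qed.

Lemma opB x y : dom A x -> dom A y -> A (x - y) = A x - A y.
Proof. by move=> dx dy; rewrite opD ?opN //; exact: domN. Qed.

Lemma dom_sum (I : Type) (s : seq I) (F : I -> H) :
  (forall i, dom A (F i)) -> dom A (\sum_(i <- s) F i).
Proof.
move=> dF; elim/big_rec: _ => [|i x _ dx]; first exact: dom0.
exact: domD.
Qed.

End Linear.

Variable A : operator H.
Hypothesis A_sa : self_adjoint ip A.

Lemma sa_lin : linear_operator A. Proof. by case: A_sa. Qed.

Lemma sa_ip x y : dom A x -> dom A y -> ip (A x) y = ip x (A y).
Proof.
by case: A_sa => _ _ adj dx dy; exact: ((adj y (A y)).2 (conj dy erefl)).
Qed.

Lemma sa_sym x y : dom A x -> dom A y -> rip (A x) y = rip x (A y).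
Proof. by move=> dx dy; rewrite /realip sa_ip. Qed.

(** Real parts suffice because the domain is a complex subspace: the test vector -i x yields the
    imaginary part of the adjoint relation. *)
Lemma sa_adj y z : (forall x, dom A x -> rip (A x) y = rip x z) ->
  dom A y /\ A y = z.
Proof.
case: A_sa => lin _ adj h; apply/adj => x dx.
have := h _ dx; have := h _ (domZ lin (- 'i) dx).
rewrite (opZ lin) // !ripZC; have -> : (- 'i)^*%C = 'i :> R[i].
  by apply/eqP; rewrite eq_complex /= oppr0 opprK !eqxx.
rewrite !rip_i /realip.
by case: (ip (A x) y) (ip x z) => a b [c d] /= -> ->.
Qed.

(** An adjoint graph is cut out by conditions continuous in both components, hence is closed. *)
Lemma sa_closed y z :
  (forall e, 0 < e -> exists x, [/\ dom A x, rnorm (y - x) < e & rnorm (z - A x) < e]) ->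
  dom A y /\ A y = z.
Proof.
move=> h; apply: sa_adj => w dw; apply/eqP; rewrite -subr_eq0; apply/eqP.
apply: (@eps_eq0 _ _ (rnorm (A w) + rnorm w)) => e e0.
have [x [dx yx zx]] := h e e0.
have -> : rip (A w) y - rip w z = rip (A w) (y - x) - rip w (z - A x).
  by rewrite !(ripDr, ripNr) (sa_sym dw dx); ring.
apply: le_trans (ler_normB _ _) _; rewrite mulrDl lerD //.
  by apply: le_trans (rip_le_norm ip_norm _ _) _; rewrite ler_wpM2l ?rnorm_ge0 // ltW.
by apply: le_trans (rip_le_norm ip_norm _ _) _; rewrite ler_wpM2l ?rnorm_ge0 // ltW.
Qed.

(** f is defined everywhere and moves across the inner product, so the adjoint relation of the sum
    is that of A with z replaced by z - f y. A plain function is allowed because [schur_lift] builds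
    its perturbation pointwise. *)
Lemma sa_add (f : H -> H) :
  (forall (a : R[i]) x y, f (a *: x + y) = a *: f x + f y) -> symmetric_op ip f ->
  self_adjoint ip (Operator (dom A) (fun x => A x + f x)).
Proof.
have [lin A_dense adj] := A_sa; move=> flin fsym; split=> //.
  split; first exact: (dom0 lin).
  move=> a x y dx dy; split; first exact: (domP lin).
  by rewrite /= (opP lin) // flin scalerDr addrACA.
move=> y z; split.
  move=> h; have [dy Ay] : dom A y /\ A y = z - f y.
    apply/adj => x dx; have := h x dx.
    by rewrite /= ipDl ipDr ipNr => <-; rewrite fsym addrK.
  by split => //=; rewrite Ay subrK.
move=> [/= dy <-] x dx; rewrite /= ipDl ipDr fsym; congr (_ + _).
exact: sa_ip.
Qed.

(** The lower bound makes preimages of a convergent sequence Cauchy, so the range is closed; its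
    orthogonal complement is the kernel of A minus the conjugate of t, which is trivial. Complex t
    serves the non-real resolvent points. *)
Lemma sa_onto (t : R[i]) (c : R) : 0 < c ->
  (forall x, dom A x -> c * rnorm x <= rnorm (A x - t *: x)) ->
  (forall v, dom A v -> A v = t^*%C *: v -> v = 0) ->
  forall y, exists2 x, dom A x & A x - t *: x = y.
Proof.
move=> c0 low inj y; have lin := sa_lin.
pose C := [set A x - t *: x | x in dom A].
have Csub : real_subspace C.
  split; first by exists 0; rewrite ?(op0 lin) ?scaler0 ?subrr //; exact: (dom0 lin).
  move=> r _ _ [u du <-] [v dv <-]; exists (r%:C *: u + v); first exact: (domP lin).
  rewrite (opP lin) // scalerDr opprD scalerBr addrACA; congr (_ - _ + _).
  by rewrite !scalerA mulrC.
have [p [pC py]] := orth_decomposition ip_norm y Csub.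
have ex_u n : exists v, dom A v /\ rnorm (p - (A v - t *: v)) < n.+1%:R^-1.
  have [|_ [v dv <-] lt_v] := pC n.+1%:R^-1.
    by rewrite invr_gt0.
  by exists v.
have [u hu] := choice ex_u.
have du n : dom A (u n) by case: (hu n).
have up e : 0 < e -> exists N, forall n, (N <= n)%N ->
    rnorm (p - (A (u n) - t *: u n)) < e.
  move=> e0; have [N hN] := inv_succ_lt e0; exists N => n Nn.
  by apply: lt_trans (hN _ Nn); case: (hu n).
have [x ux] : exists l, forall e, 0 < e -> exists N, forall n, (N <= n)%N ->
    rnorm (u n - l) < e.
  apply: complete_seq => e e0.
  have e1 : 0 < c * e / 2 by rewrite divr_gt0 ?mulr_gt0.
  have [N hN] := up _ e1; exists N => m n Nm Nn.
  rewrite -(ltr_pM2l c0); apply: le_lt_trans (low _ (domB lin (du m) (du n))) _.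
  rewrite (opB lin) //.
  have -> : A (u m) - A (u n) - t *: (u m - u n) =
     (p - (A (u n) - t *: u n)) - (p - (A (u m) - t *: u m)).
    apply: (rip_inj ip_norm) => w.
    by rewrite !(ripDl, ripNl) scalerBr !(ripDl, ripNl); ring.
  apply: le_lt_trans (rnormD _ _) _; rewrite rnormN.
  by have := hN _ Nm; have := hN _ Nn; lra.
have [dx Ax] : dom A x /\ A x = t *: x + p.
  apply: sa_closed => e e0.
  pose k := complex.Re `|t| + 1.
  have k1 : 1 <= k.
    rewrite /k lerDr; have : 0 <= `|t| by [].
    by rewrite lecE => /andP[].
  have e1 : 0 < e / (2 * k) by rewrite divr_gt0 //; lra.
  have [N1 hN1] := up _ e1; have [N2 hN2] := ux _ e1.
  have := hN1 _ (leq_maxl N1 N2); have := hN2 _ (leq_maxr N1 N2).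
  set n := maxn N1 N2 => h2 h1.
  have ek : e / (2 * k) <= e by rewrite ler_pdivrMr; nra.
  exists (u n); split => //; first by rewrite rnormB; apply: lt_le_trans h2 ek.
  have -> : t *: x + p - A (u n) = t *: (x - u n) + (p - (A (u n) - t *: u n)).
    apply: (rip_inj ip_norm) => w.
    by rewrite scalerBr !(ripDl, ripNl); ring.
  apply: le_lt_trans (rnormD _ _) _; rewrite rnormZ rnormB.
  have : complex.Re `|t| * rnorm (u n - x) <= (k - 1) * (e / (2 * k)).
    by rewrite /k addrK ler_wpM2l ?(ltW h2) //; move: k1; rewrite /k; lra.
  have -> : (k - 1) * (e / (2 * k)) = e / 2 - e / (2 * k) by field; lra.
  by move: h1 h2; lra.
exists x => //; rewrite Ax addrC addKr.
apply/esym/eqP; rewrite -subr_eq0; apply/eqP.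
have [dq Aq] : dom A (y - p) /\ A (y - p) = t^*%C *: (y - p).
  apply: sa_adj => w dw; have := py _ (ex_intro2 _ _ w dw erefl).
  by rewrite ripDl ripNl ripZC => /eqP; rewrite subr_eq0 => /eqP.
exact: inj.
Qed.

(* Locked, so that bilinear expansion of rip does not see through it. *)
Fact shift_key : unit. Proof. exact tt. Qed.
Definition shift : operator H -> R -> H -> H :=
  locked_with shift_key (fun S t x => S x - t%:C *: x).

Lemma shiftE S t x : shift S t x = S x - t%:C *: x.
Proof. by rewrite /shift; case: shift_key. Qed.

(** On the whole space this expresses that a real t is a resolvent point ([resolvent_real]); the
    restriction to K expresses that t leaves the spectrum once finitely many eigenvectors are split
    off. *)
Definition bounded_below_on (S : operator H) (K : set H) (t : R) : Prop :=
  exists2 c : R, 0 < c & forall x, dom S x -> K x -> c * rnorm x <= rnorm (shift S t x).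

Lemma shiftP t r x y : dom A x -> dom A y ->
  shift A t (r%:C *: x + y) = r%:C *: shift A t x + shift A t y.
Proof.
move=> dx dy; rewrite !shiftE (opP sa_lin) //; apply: (rip_inj ip_norm) => w.
by rewrite !ripE; ring.
Qed.

Lemma shiftB t x y : dom A x -> dom A y ->
  shift A t (x - y) = shift A t x - shift A t y.
Proof.
move=> dx dy; rewrite !shiftE (opB sa_lin) //; apply: (rip_inj ip_norm) => w.
by rewrite !ripE; ring.
Qed.

Lemma shift_shift t s x : shift A t x = shift A s x + (s - t)%:C *: x.
Proof. by rewrite !shiftE; apply: (rip_inj ip_norm) => w; rewrite !ripE; ring. Qed.

Lemma shift_sym t x y : dom A x -> dom A y ->
  rip (shift A t x) y = rip x (shift A t y).
Proof. by move=> dx dy; rewrite !shiftE !ripE sa_sym. Qed.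

Lemma shift_onto t : bounded_below_on A setT t ->
  forall y, exists2 x, dom A x & shift A t x = y.
Proof.
move=> [c c0 low] y.
have [x dx|v dv Av|x dx xE] := @sa_onto t%:C c c0 _ _ y.
- by rewrite -shiftE; exact: low.
- have := low v dv I; rewrite shiftE Av conjc_real subrr rnorm0.
  by rewrite pmulr_rle0 // => v0; apply: rnorm_eq0; apply/eqP; rewrite eq_le v0 rnorm_ge0.
- by exists x => //; rewrite shiftE.
Qed.

End SelfAdjoint.

(** * Spectral gaps *)

Section Gap.
Variables (R : realType) (H : completeNormedModType R[i]).
Variable ip : {dot H for Num.conj}.
Hypothesis ip_norm : forall x : H, ip x x = `|x| ^+ 2.
Variable A : operator H.
Hypothesis A_sa : self_adjoint ip A.
Implicit Types (x y z : H) (r : R) (K : set H).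

Local Notation rip := (realip ip).
Local Notation shift := (shift A).

(* If nu, the supremum of <z, (A-s)z> / |(A-s)z|^2 over K, exceeded
   1 / (b - s), then Cauchy-Schwarz for the nonnegative form
   nu <(A-s)z, (A-s)z'> - <z, (A-s)z'> would show that A - (s + 1/nu) is not
   bounded below on K. *)
Lemma gap_right K (s b : R) : real_subspace K ->
  (forall z, dom A z -> K z -> K (A z)) ->
  (forall z, dom A z -> K (shift s z) -> K z) ->
  bounded_below_on A setT s ->
  (forall t, s < t -> t < b -> bounded_below_on A K t) ->
  forall z, dom A z -> K z -> s < b -> 0 <= rip (shift s z) (shift b z).
Proof.
move=> [K0 KD] KA Kinv low_s gap z0 dz0 Kz0 sb.
have lin := sa_lin A_sa.
have onto := shift_onto ip_norm A_sa low_s.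
have [c0 c0_gt0 low] := low_s.
(* With u = (A - s) z0 the claim expands to |u|^2 - (b - s) <z0, u> >= 0. *)
suff key : rip z0 (shift s z0) <= (b - s)^-1 * rip (shift s z0) (shift s z0).
  rewrite (shift_shift ip_norm A b s) ripDr ripZr (ripC _ (shift s z0) z0).
  have := ler_wpM2l (ltW (_ : 0 < b - s)) key; rewrite mulVKf ?subr_gt0 ?subr_eq0 ?gt_eqF //.
  by lra.
rewrite leNgt; apply/negP => bad.
have norm_gt0 z : dom A z -> z != 0 -> 0 < rip (shift s z) (shift s z).
  move=> dz z_neq0; rewrite (ripxx ip_norm) exprn_gt0 //.
  by apply: lt_le_trans (low z dz I); rewrite mulr_gt0 ?rnorm_gt0.
pose q z := rip z (shift s z) / rip (shift s z) (shift s z).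
pose S := [set q z | z in [set z | [/\ dom A z, K z & z != 0]]].
have z0_neq0 : z0 != 0.
  apply/eqP => z00; move: bad.
  by rewrite z00 rip0l !shiftE (op0 lin) scaler0 subrr rip0l mulr0 ltxx.
have Sub : ubound S c0^-1.
  move=> _ [z [dz Kz z_neq0] <-]; rewrite /q ler_pdivrMr ?norm_gt0 //.
  apply: le_trans (rip_le ip_norm _ _) _; rewrite (ripxx ip_norm) expr2 mulrA.
  by rewrite ler_wpM2r ?rnorm_ge0 // ler_pdivlMl // low.
have Ssup : has_sup S by split; [exists (q z0), z0|exists c0^-1].
pose nu := sup S.
have nu_gt : (b - s)^-1 < nu.
  apply: lt_le_trans (_ : q z0 <= _).
    by rewrite /q ltr_pdivlMr // norm_gt0.
  by apply: ub_le_sup; [exists c0^-1|exists z0].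
have bs0 : 0 < (b - s)^-1 by rewrite invr_gt0 subr_gt0.
have nu0 : 0 < nu by apply: lt_trans nu_gt.
(* nu > 1/(b - s) puts s + 1/nu strictly between s and b. *)
have [||c c_gt0 lowt] := gap (s + nu^-1).
- by rewrite ltrDl invr_gt0.
- by rewrite -ltrBrDl -[X in _ < X]invrK ltf_pV2 ?posrE.
pose N z z' := nu * rip (shift s z) (shift s z') - rip z (shift s z').
have N_ge0 z : dom A z -> K z -> 0 <= N z z.
  move=> dz Kz; have [->|z_neq0] := eqVneq z 0.
    by rewrite /N !shiftE (op0 lin) scaler0 subrr !rip0l mulr0 subrr.
  rewrite /N subr_ge0 -ler_pdivrMr ?norm_gt0 //.
  by apply: ub_le_sup; [exists c0^-1|exists z].
(* k collects the constants of [Nz] and [u_le]; choosing z within 1/(2k) of the supremum then ends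
   in |w|^2 <= |w|^2 / 2. *)
pose k := (nu + c0^-1) * (1 + (nu * c)^-1) ^+ 2 / nu ^+ 2.
have nuc : 0 < nu * c by rewrite mulr_gt0.
have k0 : 0 < k.
  rewrite divr_gt0 ?exprn_gt0 // mulr_gt0 ?exprn_gt0 //; last first.
    by rewrite addr_gt0 // invr_gt0.
  by rewrite addr_gt0 // invr_gt0.
have e0 : 0 < (2 * k)^-1 by rewrite invr_gt0 mulr_gt0.
have [_ [z [dz Kz z_neq0] <-] z_near] := sup_adherent e0 Ssup.
(* w equals nu times (A - (s + 1/nu)) z. Its preimage z' under A - s satisfies N z z' = |w|^2, so
   Cauchy-Schwarz for N bounds |w|^2 by the small number N z z. *)
pose w := nu%:C *: shift s z - z.
have wE : w = nu%:C *: shift (s + nu^-1) z.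
  rewrite /w (shift_shift ip_norm A (s + nu^-1) s).
  by apply: (rip_inj ip_norm) => v; rewrite !ripE; field; rewrite gt_eqF.
have [z' dz' z'E] := onto w.
have Kw : K w.
  have Ku : K (shift s z).
    rewrite !shiftE addrC -scaleNr -rmorphN; by apply: (KD (- s)) => //; exact: KA.
  rewrite /w addrC -scaleN1r; have -> : (-1 : R[i]) = (-1)%:C by rewrite rmorphN.
  by apply: (KD (-1)) => //; rewrite -[_ *: _]addr0; apply: (KD nu).
have Kz' : K z' by apply: Kinv => //; rewrite z'E.
have CS : N z z' ^+ 2 <= N z z * N z' z'.
  apply: discriminant_le => [|t]; first exact: N_ge0.
  have := N_ge0 _ (domP lin t%:C dz' dz) (KD t _ _ Kz' Kz).
  rewrite /N (shiftP ip_norm A_sa) // !ripE.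
  rewrite (ripC _ (shift s z') (shift s z)) -(shift_sym A_sa s dz' dz) (ripC _ (shift s z') z).
  by lra.
have Nw : N z z' = rip w w.
  by rewrite /N z'E {3}/w !ripE; ring.
have N'w : N z' z' <= (nu + c0^-1) * rip w w.
  rewrite /N z'E mulrDl lerD2l.
  apply: le_trans (_ : `|rip z' w| <= _); first by rewrite -normrN ler_norm.
  apply: le_trans (rip_le_norm ip_norm _ _) _; rewrite (ripxx ip_norm) expr2 mulrA.
  by rewrite ler_wpM2r ?rnorm_ge0 // ler_pdivlMl // -z'E low.
have w_neq0 : 0 < rnorm w.
  rewrite wE rnormZR mulr_gt0 ?normr_gt0 ?gt_eqF //.
  by apply: lt_le_trans (lowt z dz Kz); rewrite mulr_gt0 ?rnorm_gt0.
have w2 : 0 < rip w w by rewrite (ripxx ip_norm) exprn_gt0.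
have Nz : rip w w <= N z z * (nu + c0^-1).
  rewrite -(ler_pM2r w2) -expr2 -{1}Nw -mulrA; apply: le_trans CS _.
  by rewrite ler_wpM2l // N_ge0.
have u_le : rnorm (shift s z) <= (1 + (nu * c)^-1) / nu * rnorm w.
  have zw : rnorm z <= (nu * c)^-1 * rnorm w.
    rewrite ler_pdivlMl // wE rnormZR gtr0_norm // -mulrA ler_wpM2l ?(ltW nu0) //.
    exact: lowt.
  have : nu * rnorm (shift s z) <= rnorm w + rnorm z.
    rewrite -(gtr0_norm nu0) -rnormZR.
    have -> : nu%:C *: shift s z = w + z by rewrite /w subrK.
    exact: rnormD.
  rewrite mulrAC ler_pdivlMr // mulrC mulrDl mul1r => /le_trans; apply.
  by rewrite lerD2l.
have Nzz : N z z < (2 * k)^-1 * rip (shift s z) (shift s z).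
  have := z_near; rewrite /q ltr_pdivlMr ?norm_gt0 // mulrBl /N -/nu; lra.
have u2 : rip (shift s z) (shift s z) <= ((1 + (nu * c)^-1) / nu) ^+ 2 * rip w w.
  rewrite !(ripxx ip_norm) -exprMn ler_pXn2r ?nnegrE ?rnorm_ge0 //.
  by apply: le_trans u_le; exact: rnorm_ge0.
have c0i : 0 < nu + c0^-1 by rewrite addr_gt0 // invr_gt0.
suff : rip w w <= 2^-1 * rip w w by lra.
apply: le_trans Nz _.
apply: le_trans (_ : (2 * k)^-1 * (((1 + (nu * c)^-1) / nu) ^+ 2 * rip w w) * (nu + c0^-1) <= _).
  rewrite ler_wpM2r ?(ltW c0i) //; apply: le_trans (ltW Nzz) _.
  by rewrite ler_wpM2l ?(ltW e0).
rewrite le_eqVlt; apply/orP; left; apply/eqP.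
have -> : (2 * k)^-1 * (((1 + (nu * c)^-1) / nu) ^+ 2 * rip w w) * (nu + c0^-1)
   = (2 * k)^-1 * k * rip w w by rewrite /k expr_div_n; ring.
by field; rewrite gt_eqF.
Qed.

(** [gap_right] asks for a lower bound at its left endpoint, and a may be spectral; it is applied at
    a + d, and d tends to 0. *)
Lemma gap_open (a b : R) : a < b ->
  (forall t, a < t -> t < b -> bounded_below_on A setT t) ->
  forall z, dom A z -> 0 <= rip (shift a z) (shift b z).
Proof.
move=> ab gap z dz; apply: (@eps_le _ _ _ `|rip z (shift b z)|) => e e0.
pose d := Num.min e ((b - a) / 2).
have d0 : 0 < d by rewrite lt_min e0 divr_gt0 ?subr_gt0.
have de : d <= e by rewrite ge_min lexx.
have db : d <= (b - a) / 2 by rewrite ge_min lexx orbT.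
have : 0 <= rip (shift (a + d) z) (shift b z).
  apply: (@gap_right setT) => //; [|move=> t at_ tb; apply: gap => //|]; try lra.
  by apply: gap; lra.
rewrite (shift_shift ip_norm A (a + d) a) ripDl ripZl.
have := ler_norm (- rip z (shift b z)); rewrite normrN.
have := normr_ge0 (rip z (shift b z)); nra.
Qed.

(** Takes the place of the spectral theorem at an isolated point. With a regular point c just right
    of t, the gaps on both sides of t make A - t bounded below on the vectors z1 with (A - c) z1 in
    ran (A - t); this range is dense in the orthogonal complement of the kernel, and the bound
    passes to the limit. *)
Lemma isolated_bounded_below (t eps : R) : 0 < eps ->
  (forall s, t - eps < s -> s < t + eps -> s != t -> bounded_below_on A setT s) ->
  bounded_below_on A
    [set x | forall v, dom A v -> A v = t%:C *: v -> rip x v = 0] t.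
Proof.
move=> e0 iso; have lin := sa_lin A_sa.
pose d := eps / 2; pose c := t + d.
have d0 : 0 < d by rewrite divr_gt0.
have de : d < eps by rewrite /d; lra.
have low_c : bounded_below_on A setT c.
  by apply: iso; rewrite /c; [lra|lra|rewrite gt_eqF //; lra].
have gapr z : dom A z -> 0 <= rip (shift t z) (shift c z).
  apply: gap_open => [|s ts sc]; first by rewrite /c; lra.
  by apply: iso; [lra|move: sc; rewrite /c; lra|rewrite gt_eqF].
have gapl z : dom A z -> 0 <= rip (shift (t - d) z) (shift t z).
  apply: gap_open => [|s ts sc]; first by lra.
  by apply: iso; [lra|lra|rewrite lt_eqF].
have onto := shift_onto ip_norm A_sa low_c.
have [k k0 low] := low_c.
pose br z z' := rip (shift t z) (shift c z').
have brC z z' : dom A z -> dom A z' -> br z z' = br z' z.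
  move=> dz dz'; rewrite /br !(shift_shift ip_norm A c t) !ripDr !ripZr.
  by rewrite (ripC _ (shift t z)) (shift_sym A_sa t dz dz') (ripC _ z).
(* The gap (t, c) makes [br] a nonnegative form, and br z z1 = |(A - t) z|^2 while br z1 z1 = <(A -
   t) z1, (A - t) z>. *)
have ran_low z z1 : dom A z -> dom A z1 -> shift c z1 = shift t z ->
    2^-1 * rnorm (shift t z) <= rnorm (shift t z1).
  move=> dz dz1 z1E.
  have CS : br z z1 ^+ 2 <= br z z * br z1 z1.
    apply: discriminant_le => [|r]; first exact: gapr.
    have := gapr _ (domP lin r%:C dz1 dz).
    rewrite !(shiftP ip_norm A_sa) // !ripE -!/(br _ _) (brC _ _ dz1 dz).
    by lra.
  (* The gap left of t enters here: since c = t + d, A - (t - d) is 2 (A - t) - (A - c). *)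
  have a2 : br z z <= 2 * br z z1.
    have := gapl z dz; have -> : shift (t - d) z = 2%:C *: shift t z - shift c z.
      rewrite !shiftE /c.
      by apply: (rip_inj ip_norm) => v; rewrite !ripE; ring.
    rewrite ripDl ripNl ripZl (ripC _ (shift c z)) -/(br _ _) /br z1E.
    by lra.
  have a3 : 2^-1 * br z z1 <= br z1 z1.
    have := gapr _ dz; have := gapr _ dz1; rewrite -!/(br _ _).
    move: a2 CS; move: (br z z) (br z z1) (br z1 z1) => x y w.
    have [y0|y0] := ltrP 0 y; nra.
  have [u0|u0] := eqVneq (shift t z) 0.
    by rewrite u0 rnorm0 mulr0 rnorm_ge0.
  rewrite -(ler_pM2r (rnorm_gt0 u0)) -mulrA -expr2 -(ripxx ip_norm).
  apply: le_trans (rip_le ip_norm _ _).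
  by move: a3; rewrite /br z1E.
exists (2^-1 * k) => [|y dy y_ker]; first by rewrite mulr_gt0.
have u_orth v : dom A v -> A v = t%:C *: v -> rip (shift c y) v = 0.
  move=> dv Av; rewrite (shift_sym A_sa c dy dv) !shiftE Av.
  by rewrite -scalerBl -rmorphB ripZr y_ker // mulr0.
(* The component of (A - c) y orthogonal to ran (A - t) is in the kernel of A - t, to which (A - c)
   y is orthogonal; hence it vanishes and (A - c) y is a limit of vectors (A - t) z. *)
pose C := [set shift t z | z in dom A].
have Csub : real_subspace C.
  split; first by exists 0; rewrite ?shiftE ?(op0 lin) ?scaler0 ?subrr //; exact: dom0.
  move=> r _ _ [u du <-] [v dv <-]; exists (r%:C *: u + v); first exact: domP.
  by rewrite (shiftP ip_norm A_sa).
have [p [pC py]] := orth_decomposition ip_norm (shift c y) Csub.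
have [dq Aq] : dom A (shift c y - p) /\ A (shift c y - p) = t%:C *: (shift c y - p).
  apply: (sa_adj A_sa) => w dw; have := py _ (ex_intro2 _ _ w dw erefl).
  by rewrite !shiftE ripDl ripNl ripZl ripZr => /eqP; rewrite subr_eq0 => /eqP.
have q0 : shift c y - p = 0.
  apply: (rip_eq0 ip_norm); rewrite {1}[shift c y - p]addrC ripDl u_orth // addr0 ripNl.
  apply/eqP; rewrite oppr_eq0; apply/eqP.
  apply: (@eps_eq0 _ _ (rnorm (shift c y - p))) => e e_gt0.
  have [_ [z dz <-] zp] := pC e e_gt0.
  have -> : rip p (shift c y - p) = rip (p - shift t z) (shift c y - p).
    rewrite (ripDl _ p) ripNl (shift_sym A_sa t dz dq).
    by rewrite (shiftE _ t) Aq subrr rip0r subr0.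
  apply: le_trans (rip_le_norm ip_norm _ _) _.
  by rewrite mulrC ler_wpM2l ?rnorm_ge0 // ltW.
have pE : p = shift c y by apply/esym/eqP; rewrite -subr_eq0 q0.
(* 1/2 comes from replacing (A - c) y by (A - t) z, and 1 + d/k bounds (A - t)(z1 - y), because A -
   t = (A - c) + d and |y - z1| <= e/k. *)
apply: (@eps_le _ _ _ (2^-1 + (1 + d * k^-1))) => e e_gt0.
have [_ [z dz <-] zp] := pC e e_gt0.
have [z1 dz1 z1E] := onto (shift t z).
have h1 := ran_low _ _ dz dz1 z1E.
have h2 := low _ dy I.
have d1 : dom A (y - z1) := domB lin dy dz1.
have h3 : rnorm (shift c (y - z1)) < e.
  by rewrite (shiftB ip_norm A_sa) // z1E -pE.
have h4 := low _ d1 I.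
have h5 : rnorm (shift t (z1 - y)) <= (1 + d * k^-1) * e.
  rewrite (shift_shift ip_norm A t c) /c addrAC subrr add0r.
  apply: le_trans (rnormD _ _) _; rewrite mulrDl mul1r rnormZR gtr0_norm //.
  have d1' : dom A (z1 - y) := domB lin dz1 dy.
  rewrite (shiftB ip_norm A_sa) // rnormB -(shiftB ip_norm A_sa) // rnormB.
  apply: lerD; first exact: ltW.
  rewrite -mulrA ler_wpM2l ?(ltW d0) // ler_pdivlMl //.
  by apply: le_trans h4 _; exact: ltW.
have h6 : rnorm (shift t z1) <= rnorm (shift t y) + rnorm (shift t (z1 - y)).
  apply: le_trans (rnormD _ _); rewrite (shiftB ip_norm A_sa) //.
  by rewrite addrC subrK.
have h7 : rnorm (shift c y) <= rnorm (shift t z) + e.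
  apply: le_trans (_ : rnorm (shift t z) + rnorm (p - shift t z) <= _).
    by rewrite -pE; apply: le_trans (rnormD _ _); rewrite addrC subrK.
  by rewrite lerD2l ltW.
by move: h1 h2 h5 h6 h7; lra.
Qed.

End Gap.

(** * Comparison across a gap *)

Lemma kernel_combination (K : fieldType) (k : nat) (F : 'I_k.+1 -> 'I_k -> K) :
  exists c : 'I_k.+1 -> K, (exists i, c i != 0) /\
    forall j, \sum_i c i * F i j = 0.
Proof.
pose M := \matrix_(i < k.+1, j < k) F i j.
have kM : kermx M != 0.
  rewrite kermx_eq0 /row_free neq_ltn; apply/orP; left.
  by rewrite ltnS; exact: rank_leq_col.
have := nz_row_sub (kermx M); set u := nz_row _ => /sub_kermxP uM.
have u0 : u != 0 by rewrite nz_row_eq0.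
exists (fun i => u 0 i); split.
  by have /rV0Pn[i ui] := u0; exists i.
move=> j; have := congr1 (fun X : 'rV_k => X 0 j) uM.
by rewrite !mxE => uMj; rewrite -[RHS]uMj; apply: eq_bigr => i _; rewrite !mxE.
Qed.

Lemma sum_subspace (K : fieldType) (H : lmodType K) (S : set H) (I : Type)
  (s : seq I) (c : I -> K) (F : I -> H) :
  S 0 -> (forall a x y, S x -> S y -> S (a *: x + y)) -> (forall i, S (F i)) ->
  S (\sum_(i <- s) c i *: F i).
Proof. by move=> S0 SD SF; elim/big_rec: _ => // i x _; exact: SD. Qed.

Section Comparison.
Variables (R : realType) (H : completeNormedModType R[i]).
Variable ip : {dot H for Num.conj}.
Hypothesis ip_norm : forall x : H, ip x x = `|x| ^+ 2.
Variable A : operator H.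
Hypothesis A_sa : self_adjoint ip A.
Variables B P : {linear H -> H}.
Hypothesis B_sym : symmetric_op ip B.
Hypothesis P_proj : orthogonal_projection ip P.
Hypothesis P_dom : forall x, dom A x -> dom A (P x).
Hypothesis P_comm : forall x, dom A x -> A (P x) + B (P x) = P (A x + B x).
Variables (gamma mu : R).
Hypothesis gamma_mu : gamma < mu.
Hypothesis A_neg : forall z, dom A z -> P z = z ->
  realip ip (A z) z <= gamma * realip ip z z.
Hypothesis A_pos : forall z, dom A z -> P z = 0 ->
  gamma * realip ip z z <= realip ip (A z) z.
Hypothesis AB_pos : forall z, dom A z -> P z = 0 ->
  gamma * realip ip z z <= realip ip (A z + B z) z.

Local Notation rip := (realip ip).
Local Notation shift := (shift A).

Let PP x : P (P x) = P x. Proof. exact: P_proj.1. Qed.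
Let P_sym x y : rip (P x) y = rip x (P y).
Proof. by rewrite /realip P_proj.2. Qed.
Let PB x y : P (x - y) = P x - P y. Proof. exact: raddfB. Qed.
Let PD x y : P (x + y) = P x + P y. Proof. exact: raddfD. Qed.
Let PZ (a : R[i]) x : P (a *: x) = a *: P x. Proof. exact: linearZ_LR. Qed.

(* Schur complement: l solves (P A P - mu) l = P B w.  To stay with operators
   on all of H, P A P - mu is extended by A + B - (gamma - 1) on ker P. *)
Lemma schur_lift w : dom A w -> P w = 0 ->
  exists l, [/\ dom A l, P l = l & P (shift mu (w + l)) = 0].
Proof.
move=> dw Pw; have lin := sa_lin A_sa.
pose f x := B x - P (B (P x)) - mu%:C *: P x - (gamma - 1)%:C *: (x - P x).
have f_lin a x y : f (a *: x + y) = a *: f x + f y.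
  rewrite /f !linearP !raddfD /= !linearZ /=; apply: (ip_inj ip_norm) => v.
  by rewrite !(ipDl, ipNl, ipZl); ring.
have f_sym : symmetric_op ip f.
  move=> x y; rewrite /f !(ipDl, ipNl, ipZl) !(ipDr, ipNr, ipZr) !conjc_real.
  by rewrite B_sym !P_proj.2 B_sym P_proj.2.
pose T := Operator (dom A) (fun x => A x + f x).
have T_sa : self_adjoint ip T by exact: sa_add.
(* The block of T on ran P is at most -(mu - gamma); the shift by gamma - 1 makes the block on ker P
   at least 1. *)
pose d := Num.min (mu - gamma) 1.
have d0 : 0 < d by rewrite lt_min subr_gt0 gamma_mu /=.
have TP x : dom A x -> T (P x) = P (T x).
  move=> dx; rewrite /= /f.
  have -> : A (P x) + (B (P x) - P (B (P (P x))) - mu%:C *: P (P x)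
      - (gamma - 1)%:C *: (P x - P (P x))) =
    (A (P x) + B (P x)) - P (B (P x)) - mu%:C *: P x.
    by rewrite !PP subrr scaler0 subr0 !addrA.
  rewrite P_comm // ![in RHS]addrA. rewrite !PB !PZ PB !PP subrr.
  by rewrite scaler0 subr0.
have low x : dom A x -> d * rnorm x <= rnorm (T x - 0 *: x).
  move=> dx; rewrite scale0r subr0.
  have da : dom A (P x) by exact: P_dom.
  have db : dom A (x - P x) by exact: domB.
  pose a := P x; pose b := x - P x.
  have Pa : P a = a by exact: PP.
  have Pb : P b = 0 by rewrite /b PB PP subrr.
  have ab : rip a b = 0 by rewrite /a P_sym Pb rip0r.
  have xE : x = a + b by rewrite /a /b addrC subrK.
  have Ta : rip (T x) a <= - (mu - gamma) * rip a a.
    have -> : rip (T x) a = rip (T a) a by rewrite -{1}Pa -P_sym -TP.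
    rewrite /= /f Pa subrr scaler0 subr0 !ripE (P_sym (B a) a) Pa.
    have := A_neg da Pa; lra.
  have Tb : rip b b <= rip (T x) b.
    have -> : rip (T x) b = rip (T b) b.
      have -> : T b = T x - P (T x).
        by rewrite -TP // -(opB (sa_lin T_sa)).
      by rewrite ripDl ripNl P_sym Pb rip0r subr0.
    rewrite /= /f Pb !raddf0 ?scaler0 !(addr0, subr0) !ripE.
    have := AB_pos db Pb; rewrite !ripE -/b; lra.
  clearbody a b.
  have dle : d <= mu - gamma by rewrite ge_min lexx.
  have dle1 : d <= 1 by rewrite ge_min lexx orbT.
  have [->|x0] := eqVneq x 0; first by rewrite rnorm0 mulr0 rnorm_ge0.
  rewrite -(ler_pM2r (rnorm_gt0 x0)) -mulrA -expr2 -(ripxx ip_norm).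
  (* The blocks of T have opposite signs, so T x is tested against the reflected vector b - a, which
     has the norm of x. *)
  have xx : rip x x = rip (b - a) (b - a).
    by rewrite xE !ripE (ripC _ b a) ab; ring.
  have -> : rnorm x = rnorm (b - a).
    apply/eqP; rewrite -(@eqrXn2 _ 2) ?rnorm_ge0 // -!(ripxx ip_norm).
    by apply/eqP.
  apply: le_trans (rip_le ip_norm _ _).
  have : rip x x = rip a a + rip b b by rewrite xE !ripE (ripC _ b a) ab; ring.
  rewrite ripDr ripNr => ->.
  have := ler_wpM2r (rip_ge0 ip_norm a) dle.
  by have := ler_wpM2r (rip_ge0 ip_norm b) dle1; lra.
have inj v : dom A v -> T v = (0 : R[i])^*%C *: v -> v = 0.
  have -> : (0 : R[i])^*%C = 0 by apply/eqP; rewrite eq_complex /= oppr0 !eqxx.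
  move=> dv Tv; apply: rnorm_eq0; have := low v dv; rewrite Tv.
  rewrite !scale0r subrr rnorm0 pmulr_rle0 // => v0.
  by apply/eqP; rewrite eq_le v0 rnorm_ge0.
have [x dx] := sa_onto ip_norm T_sa d0 low inj (P (B w)).
(* P commutes with T, so P x solves the same equation inside ran P; and P A w = - P B w because P w
   = 0 and P commutes with A + B. *)
rewrite scale0r subr0 => Tx; exists (P x); split; [exact: P_dom|exact: PP|].
have := TP _ dx; rewrite Tx PP /= /f !PP subrr scaler0 subr0 => Tl.
have PA y : dom A y -> P (A y) = A (P y) + B (P y) - P (B y).
  by move=> dy; rewrite P_comm // PD addrK.
rewrite !shiftE (opD lin) //; last exact: P_dom.
rewrite PB PD !PA //; last exact: P_dom.
rewrite !PP PZ PD Pw PP add0r.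
rewrite -Tl raddf0 (op0 lin) !add0r; apply: (rip_inj ip_norm) => v.
by rewrite !ripE rip0l; ring.
Qed.

(* With u = (A - mu) x and y = (A - gamma)^-1 u, the gap inequality gives
   <y, u> <= <x, u> < 0, whereas P u = 0 and the block signs of A - gamma give
   <y, u> >= 0. *)
Lemma subspace_contradiction (k : nat) (v : 'I_k -> H) (w : 'I_k.+1 -> H) (m : R) :
  m < mu ->
  (forall z, dom A z -> (forall j, ip z (v j) = 0) ->
     0 <= rip (shift gamma z) (shift mu z)) ->
  (forall x, (forall j, ip x (v j) = 0) ->
     exists z, [/\ dom A z, shift gamma z = x & forall j, ip z (v j) = 0]) ->
  lin_indep w -> (forall i, dom A (w i)) -> (forall i, P (w i) = 0) ->
  (forall l c, dom A l -> P l = l ->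
     let x := \sum_i c i *: w i + l in rip (A x) x <= m * rip x x) ->
  False.
Proof.
move=> m_mu gap onto w_indep dw Pw form_le; have lin := sa_lin A_sa.
have [l hl] := choice (fun i => schur_lift (dw i) (Pw i)).
have dl i : dom A (l i) by case: (hl i).
have Pl i : P (l i) = l i by case: (hl i).
have [c [[i0 ci0] orth]] := kernel_combination (fun i j => ip (w i + l i) (v j)).
pose sw := \sum_i c i *: w i; pose sl := \sum_i c i *: l i.
pose x := sw + sl.
have xE : x = \sum_i c i *: (w i + l i).
  by rewrite /x -big_split; apply: eq_bigr => i _; rewrite scalerDr.
have dsl : dom A sl /\ P sl = sl.
  apply: (@sum_subspace R[i] H (fun x => dom A x /\ P x = x)) => [|a y z [dy Py] [dz Pz]|//].
    by split; [exact: dom0|exact: raddf0].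
  by split; [exact: domP|rewrite linearP Py Pz].
have Psw : P sw = 0.
  apply: (@sum_subspace R[i] H (fun x => P x = 0)) => [|a y z Py Pz|//]; first exact: raddf0.
  by rewrite linearP Py Pz scaler0 addr0.
have dx_Pu : dom A x /\ P (shift mu x) = 0.
  rewrite xE; apply: (@sum_subspace R[i] H (fun x => dom A x /\ P (shift mu x) = 0))
    => [|a y z [dy Py] [dz Pz]|i].
  - by split; [exact: dom0|rewrite shiftE (op0 lin) scaler0 subrr raddf0].
  - split; first exact: domP.
    have -> : shift mu (a *: y + z) = a *: shift mu y + shift mu z.
      rewrite !shiftE (opP lin) //; apply: (ip_inj ip_norm) => u.
      by rewrite !(ipDl, ipNl, ipZl); ring.
    by rewrite linearP Py Pz scaler0 addr0.
  - by split; [exact: domD|case: (hl i)].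
have [dx Pu] := dx_Pu.
have x_orth j : ip x (v j) = 0.
  rewrite xE linear_sumlz; rewrite -[RHS](orth j).
  by apply: eq_bigr => i _; exact: ipZl.
(* P x is the lifted part; if x = 0 it vanishes, leaving a vanishing nontrivial combination of the
   independent w. *)
have x_neq0 : x != 0.
  apply/eqP => x0; move: ci0.
  rewrite (w_indep c) ?eqxx //; apply/eqP; rewrite -/sw.
  have : P x = sl by rewrite PD Psw add0r dsl.2.
  by rewrite x0 raddf0 => sl0; move: x0; rewrite /x -sl0 addr0 => ->.
have x_form : rip (A x) x <= m * rip x x := form_le _ c dsl.1 dsl.2.
clearbody x.
have xu : rip x (shift mu x) < 0.
  rewrite shiftE !ripE (ripC _ x (A x)).
  by have := rip_gt0 ip_norm x_neq0; nra.
have [z [dz zx z_orth]] := onto x x_orth.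
pose u := shift mu x.
(* Resolvent identity: z = (A - gamma)^-1 x, and (A - gamma) y = (A - gamma) x - (mu - gamma) x =
   u. *)
pose y := x - (mu - gamma)%:C *: z.
have dy : dom A y by apply: domB => //; exact: domZ.
have yu : shift gamma y = u.
  rewrite /u /y !shiftE (opB lin) ?(opZ lin) //; last exact: domZ.
  have := zx; rewrite shiftE => <-.
  by rewrite /y; apply: (rip_inj ip_norm) => t; rewrite !ripE; ring.
have y_neg : rip y u < 0.
  have := gap z dz z_orth; rewrite zx -(shift_sym A_sa) // (ripC _ _ z) => zu.
  rewrite /y ripDl ripNl ripZl.
  have : 0 <= (mu - gamma) * rip z u by rewrite mulr_ge0 // subr_ge0 ltW.
  by move: xu; rewrite -/u; lra.
pose a := P y; pose b := y - P y.
have da : dom A a by exact: P_dom.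
have db : dom A b by exact: domB.
have Pa : P a = a by exact: PP.
have Pb : P b = 0 by rewrite /b PB PP subrr.
have yab : y = a + b by rewrite /a /b addrC subrK.
have au : rip a u = 0 by rewrite /a P_sym Pu rip0r.
have uE : u = shift gamma a + shift gamma b.
  rewrite -yu yab; have := shiftP ip_norm A_sa gamma 1 da db.
  by rewrite !scale1r.
clearbody a b; clearbody y u.
have h1 := A_neg da Pa; have h2 := A_pos db Pb.
(* Since <a, u> = 0, the cross term is -<a, (A - gamma) a>; thus <y, u> = <b, (A - gamma) b> - <a,
   (A - gamma) a>, a sum of two nonnegative terms. *)
have cross : rip b (shift gamma a) = rip a (shift gamma b).
  by rewrite ripC (shift_sym A_sa).
move: h1 h2 y_neg au; rewrite {1}yab ripDl uE !ripDr cross !shiftE !ripE.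
rewrite (ripC _ (A a) a) (ripC _ (A b) b); lra.
Qed.

End Comparison.

(** * Spectral measures *)

Section FirstMoment.
Variables (R : realType) (mu : {measure set (measurableTypeR R) -> \bar R}).
Variable m : R.
Hypothesis mu_fin : mu setT = m%:E.
Local Open Scope ereal_scope.

Lemma finite_mu : fin_num_fun mu.
Proof.
move=> S mS; rewrite ge0_fin_numE //; apply: le_lt_trans (_ : mu setT < +oo).
  by apply: le_measure; rewrite ?inE.
by rewrite mu_fin ltry.
Qed.

(** |t| <= 1 + t^2, and constants are integrable for a finite measure. *)
Lemma id_integrable : \int[mu]_t ((t ^+ 2)%:E) < +oo ->
  mu.-integrable setT (fun t => t%:E).
Proof.
move=> h.
have sq_int : mu.-integrable setT (fun t : R => (t ^+ 2)%:E).
  apply/integrableP; split.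
    by apply/measurable_EFinP; exact: measurable_funX.
  apply: le_lt_trans h; rewrite le_eqVlt; apply/orP; left; apply/eqP.
  apply: eq_integral => t _.
  by rewrite /= ger0_norm ?sqr_ge0.
have cst_int : mu.-integrable setT (fun=> 1%:E).
  apply/integrableP; split; first exact: measurable_cst.
  by rewrite /= integral_cst //= normr1 mul1e mu_fin ltry.
have sum_int := integrableD measurableT cst_int sq_int.
apply: (le_integrable measurableT _ _ sum_int) => [|t _ /=].
  exact/measurable_EFinP.
rewrite lee_fin; have [t0|t0] := ger0P t; rewrite ger0_norm; nra.
Qed.

Lemma first_moment_le b : mu.-integrable setT (fun t => t%:E) ->
  mu [set t | b < t]%R = 0 -> (\int[mu]_t t <= b * m)%R.
Proof.
move=> int0 null; pose N : set (measurableTypeR R) := [set t | b < t]%R.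
have mN : measurable N by rewrite /N -set_itvoy.
have mD : measurable (setT `\` N) by exact: measurableD.
have muD : mu (setT `\` N) = m%:E.
  rewrite -mu_fin -[in RHS](@setDUK _ N setT) // measureU //.
    rewrite -[LHS]add0e.
    exact: (congr1 (fun u => adde u _) (esym null)).
  by apply/seteqP; split => // t [? []].
have E := negligible_integral mN measurableT int0 null.
rewrite /Rintegral E.
have -> : (b * m)%R = fine (\int[mu]_(t in setT `\` N) b%:E).
  by rewrite integral_cst // muD.
have i1 : mu.-integrable (setT `\` N) (fun t => t%:E).
  exact: integrableS int0.
have i2 : mu.-integrable (setT `\` N) (fun=> b%:E).
  apply/integrableP; split; first exact: measurable_cst.
  by rewrite /= integral_cst // muD -EFinM ltry.
apply: fine_le; [exact: integrable_fin_num|exact: integrable_fin_num|].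
apply: le_integral => // t; rewrite inE => -[_ /= /negP].
by rewrite -leNgt lee_fin.
Qed.

Lemma first_moment_ge a : mu.-integrable setT (fun t => t%:E) ->
  mu [set t | t < a]%R = 0 -> (a * m <= \int[mu]_t t)%R.
Proof.
move=> int0 null; pose N : set (measurableTypeR R) := [set t | t < a]%R.
have mN : measurable N by rewrite /N -set_itvNyo.
have mD : measurable (setT `\` N) by exact: measurableD.
have muD : mu (setT `\` N) = m%:E.
  rewrite -mu_fin -[in RHS](@setDUK _ N setT) // measureU //.
    rewrite -[LHS]add0e.
    exact: (congr1 (fun u => adde u _) (esym null)).
  by apply/seteqP; split => // t [? []].
have E := negligible_integral mN measurableT int0 null.
rewrite /Rintegral E.
have -> : (a * m)%R = fine (\int[mu]_(t in setT `\` N) a%:E).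
  by rewrite integral_cst // muD.
have i1 : mu.-integrable (setT `\` N) (fun t => t%:E).
  exact: integrableS int0.
have i2 : mu.-integrable (setT `\` N) (fun=> a%:E).
  apply/integrableP; split; first exact: measurable_cst.
  by rewrite /= integral_cst // muD -EFinM ltry.
apply: fine_le; [exact: integrable_fin_num|exact: integrable_fin_num|].
apply: le_integral => // t; rewrite inE => -[_ /= /negP].
by rewrite -leNgt lee_fin.
Qed.

Lemma second_moment_fin (C : R) : (0 <= C)%R -> mu [set t | C < `|t|]%R = 0 ->
  \int[mu]_t ((t ^+ 2)%:E) < +oo.
Proof.
move=> C0 null; pose N : set (measurableTypeR R) := [set t | C < `|t|]%R.
have mN : measurable N.
  have -> : N = `]C, +oo[ `|` `]-oo, (- C)%R[.
    apply/seteqP; split=> t; rewrite /N /= !in_itv /= andbT ltr_normr.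
      by case/orP => h; [left|right; rewrite ltrNr].
    by case=> h; rewrite ?h //; move: h; rewrite ltrNr => ->; rewrite orbT.
  by apply: measurableU; exact: measurable_itv.
have mD : measurable (setT `\` N) by exact: measurableD.
have msq : measurable_fun setT (fun t : R => (t ^+ 2)%:E).
  by apply/measurable_EFinP; exact: measurable_funX.
have sq_ge0 (t : measurableTypeR R) : setT t -> 0 <= ((t ^+ 2)%:E : \bar R).
  by move=> _; rewrite lee_fin sqr_ge0.
have E := ge0_negligible_integral mN measurableT msq sq_ge0 null.
rewrite E.
apply: le_lt_trans (_ : \int[mu]_(t in setT `\` N) (C ^+ 2)%:E < +oo).
  apply: ge0_le_integral => //.
  - by move=> t _; rewrite lee_fin sqr_ge0.
  - exact: measurable_funTS.
  move=> t [_ /= /negP]; rewrite -leNgt lee_fin => tC.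
  by rewrite -real_normK ?num_real // ler_pXn2r ?nnegrE.
rewrite integral_cst //=; apply: lte_mul_pinfty => //; first by rewrite lee_fin sqr_ge0.
by have := finite_mu mD; rewrite ge0_fin_numE.
Qed.

End FirstMoment.

(** * Algebra of the spectral projections and their commutation with the operator *)

Section SpectralMeasure.
Variables (R : realType) (H : completeNormedModType R[i]).
Variable ip : {dot H for Num.conj}.
Hypothesis ip_norm : forall x : H, ip x x = `|x| ^+ 2.
Variable M : operator H.
Hypothesis M_sa : self_adjoint ip M.
Variable Q : set R -> {linear H -> H}.
Hypothesis Q_spec : spectral_measure ip M Q.
Implicit Types (S T : set R) (x y : H).

Local Notation rip := (realip ip).

Lemma QQ S x : measurable S -> Q S (Q S x) = Q S x.
Proof. by case: Q_spec => -[proj _ _] _ mS; case: (proj S mS). Qed.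

Lemma Q_sym S x y : measurable S -> rip (Q S x) y = rip x (Q S y).
Proof.
by case: Q_spec => -[proj _ _] _ mS; case: (proj S mS) => _ sym; rewrite /realip sym.
Qed.

Lemma QT x : Q setT x = x.
Proof. by case: Q_spec => -[_ QT _] _. Qed.

Lemma Q_diag S x : measurable S -> rip (Q S x) x = rip (Q S x) (Q S x).
Proof. by move=> mS; rewrite -{1}(QQ x mS) (Q_sym _ _ mS). Qed.

Lemma Q_measure x : exists mu, scalar_measure ip Q x mu.
Proof. by case: Q_spec => -[_ _ mu] _. Qed.

Lemma measure_Q x mu S : scalar_measure ip Q x mu -> measurable S ->
  mu S = (rip (Q S x) x)%:E.
Proof. by move=> h mS; rewrite h. Qed.

(** A projection-valued measure is given through its quadratic forms, so additivity is known for <Q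
    S x, x> only; polarization of the symmetric defect [D] lifts it to vectors. *)
Lemma Q_U S T x : measurable S -> measurable T -> S `&` T = set0 ->
  Q (S `|` T) x = Q S x + Q T x.
Proof.
move=> mS mT ST0; have mU : measurable (S `|` T) by exact: measurableU.
have quad y : rip (Q (S `|` T) y) y = rip (Q S y + Q T y) y.
  have [mu hmu] := Q_measure y.
  have E : mu (S `|` T) = (mu S + mu T)%E := measureU mu mS mT ST0.
  move: E; rewrite (measure_Q hmu mU) (measure_Q hmu mS) (measure_Q hmu mT).
  rewrite -EFinD => -[->].
  by rewrite ripDl.
pose D y := Q (S `|` T) y - (Q S y + Q T y).
have Dadd y z : D (y + z) = D y + D z.
  by rewrite /D !raddfD /=; apply: (rip_inj ip_norm) => v; rewrite !ripE; ring.
have Dsym y z : rip (D y) z = rip y (D z).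
  by rewrite /D !ripE !Q_sym.
have D0 y : rip (D y) y = 0 by rewrite /D ripDl ripNl quad subrr.
apply/eqP; rewrite -subr_eq0 -/(D x); apply/eqP/(rip_inj ip_norm) => y.
clearbody D.
rewrite rip0l; have := D0 (x + y).
rewrite Dadd !(ripDl, ripDr) !D0 (Dsym y x) (ripC _ y (D x)); lra.
Qed.

Lemma Q_le S x : measurable S -> rip (Q S x) (Q S x) <= rip x x.
Proof.
move=> mS; have := rip_ge0 ip_norm (x - Q S x).
rewrite !ripE (ripC _ x (Q S x)) (Q_diag x mS); lra.
Qed.

(** For y = Q T x, additivity gives |Q (S u T) y|^2 = |Q S y|^2 + |y|^2, whereas a projection does
    not increase the norm. *)
Lemma Q_disjoint S T x : measurable S -> measurable T -> S `&` T = set0 ->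
  Q S (Q T x) = 0.
Proof.
move=> mS mT ST0; have mU : measurable (S `|` T) by exact: measurableU.
apply: (rip_eq0 ip_norm); apply/eqP; rewrite eq_le (rip_ge0 ip_norm) andbT.
have := Q_le (Q T x) mU; rewrite -Q_diag // Q_U // ripDl QQ //.
by rewrite Q_diag //; lra.
Qed.

Lemma Q_split S x : measurable S -> x = Q S x + Q (~` S) x.
Proof.
move=> mS; rewrite -Q_U ?setICr //; last exact: measurableC.
by rewrite setUCr QT.
Qed.

Lemma Q_subset S T x : measurable S -> measurable T -> S `<=` T ->
  Q S x = x -> Q T x = x.
Proof.
move=> mS mT ST Sx; have mD : measurable (T `\` S) by exact: measurableD.
rewrite -(setDUK ST) Q_U //; last by rewrite setDIK.
by rewrite Sx -{2}Sx Q_disjoint ?addr0 //; rewrite setIC setDIK.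
Qed.

Lemma Q_null S T x : measurable S -> measurable T -> S `&` T = set0 ->
  Q S x = x -> Q T x = 0.
Proof. by move=> mS mT ST Sx; rewrite -Sx Q_disjoint // setIC. Qed.

Lemma Q_I S T x : measurable S -> measurable T -> Q S (Q T x) = Q (S `&` T) x.
Proof.
move=> mS mT; have mI : measurable (S `&` T) by exact: measurableI.
have mD : measurable (T `\` S) by exact: measurableD.
have TE : T = (S `&` T) `|` (T `\` S) by rewrite setIC setUC setDE -setIUr setvU setIT.
rewrite {1}TE Q_U //; last by rewrite setIC setIA setDKI set0I.
rewrite raddfD /= (@Q_disjoint S (T `\` S)) //; last by rewrite setDIK.
rewrite addr0; apply: (@Q_subset (S `&` T)) => //.
exact: QQ.
Qed.

Lemma mass_Q x mu : scalar_measure ip Q x mu -> mu setT = (rip x x)%:E.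
Proof. by move=> h; rewrite (measure_Q h) // QT. Qed.

(** The mixed terms vanish by disjointness. Splitting the measure of x this way splits its moments,
    which yields domain invariance and [form_split]. *)
Lemma sum_measure S x (m1 m2 : {measure set (measurableTypeR R) -> \bar R}) :
  measurable S ->
  scalar_measure ip Q (Q S x) m1 -> scalar_measure ip Q (Q (~` S) x) m2 ->
  scalar_measure ip Q x (measure_add m1 m2).
Proof.
move=> mS h1 h2 T mT; have mC : measurable (~` S) by exact: measurableC.
transitivity (m1 T + m2 T)%E; first exact: measure_addE.
rewrite (measure_Q h1 mT) (measure_Q h2 mT) -EFinD; congr (_%:E).
rewrite -/(rip (Q T x) x) [in RHS](Q_split x mS) raddfD /= !(ripDl, ripDr).
have e1 : rip (Q T (Q S x)) (Q (~` S) x) = 0.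
  rewrite Q_I // Q_sym ?Q_disjoint ?rip0r //; last exact: measurableI.
  - exact: measurableI.
  - by rewrite -setIA setICr setI0.
have e2 : rip (Q T (Q (~` S) x)) (Q S x) = 0.
  rewrite Q_I // Q_sym ?Q_disjoint ?rip0r //; last exact: measurableI.
  - exact: measurableI.
  - by rewrite -setIA setICl setI0.
by rewrite e1 e2 addr0 add0r.
Qed.

Lemma dom_Q S x : measurable S -> dom M x -> dom M (Q S x).
Proof.
move=> mS dx; have [_ spec] := Q_spec.
have [m1 h1] := Q_measure (Q S x); have [m2 h2] := Q_measure (Q (~` S) x).
have h := sum_measure mS h1 h2; have := (spec _ _ h).1.1 dx.
rewrite ge0_integral_measure_add //; first last.
- by apply/measurable_EFinP; exact: measurable_funX.
- by move=> t _; rewrite lee_fin sqr_ge0.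
move=> fin; apply: (spec _ _ h1).1.2; apply: le_lt_trans fin.
by rewrite leeDl // integral_ge0 // => t _; rewrite lee_fin sqr_ge0.
Qed.

Lemma moment_integrable x mu : scalar_measure ip Q x mu -> dom M x ->
  mu.-integrable setT (fun t => t%:E).
Proof.
move=> h dx; have [_ spec] := Q_spec.
apply: (id_integrable (mass_Q h)); exact: (spec _ _ h).1.1.
Qed.

Lemma moment x mu : scalar_measure ip Q x mu -> dom M x ->
  rip (M x) x = (\int[mu]_t t)%R.
Proof.
by move=> h dx; have [_ spec] := Q_spec; rewrite /realip ((spec _ _ h).2 dx).
Qed.

Lemma form_split S x : measurable S -> dom M x ->
  rip (M x) x = rip (M (Q S x)) (Q S x) + rip (M (Q (~` S) x)) (Q (~` S) x).
Proof.
move=> mS dx; have mC : measurable (~` S) by exact: measurableC.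
have [m1 h1] := Q_measure (Q S x); have [m2 h2] := Q_measure (Q (~` S) x).
have h := sum_measure mS h1 h2.
have d1 := dom_Q mS dx; have d2 := dom_Q mC dx.
rewrite (moment h dx) (moment h1 d1) (moment h2 d2) /Rintegral.
have i1 := moment_integrable h1 d1; have i2 := moment_integrable h2 d2.
rewrite (integral_measure_add measurableT i1 i2) fineD //.
  exact: integrable_fin_num i1.
exact: integrable_fin_num i2.
Qed.

Lemma cross_form S x y : measurable S -> dom M x -> dom M y ->
  rip (M (Q S x)) (Q (~` S) y) = 0.
Proof.
move=> mS dx dy; have mC : measurable (~` S) by exact: measurableC.
have lin := sa_lin M_sa.
have da := dom_Q mS dx; have db := dom_Q mC dy.
have dz : dom M (Q S x + Q (~` S) y) by exact: domD.
have := form_split mS dz.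
have -> : Q S (Q S x + Q (~` S) y) = Q S x.
  by rewrite raddfD /= QQ // Q_disjoint ?addr0 ?setICr.
have -> : Q (~` S) (Q S x + Q (~` S) y) = Q (~` S) y.
  by rewrite raddfD /= QQ // Q_disjoint ?add0r ?setICl.
rewrite (opD lin) // !(ripDl, ripDr) (sa_sym M_sa db da) (ripC _ (Q (~` S) y)).
lra.
Qed.

(** The spectral measure is tied to M through quadratic forms only. The vanishing of the cross form
    gives the adjoint relation for Q S x, and self-adjointness turns it into commutation. *)
Lemma Q_comm S x : measurable S -> dom M x -> M (Q S x) = Q S (M x).
Proof.
move=> mS dx; have mC : measurable (~` S) by exact: measurableC.
have lin := sa_lin M_sa.
have [|] // := @sa_adj _ _ ip _ M_sa (Q S x) (Q S (M x)).
move=> y dy; have d1 := dom_Q mS dy; have d2 := dom_Q mC dy.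
have d1x := dom_Q mS dx; have d2x := dom_Q mC dx.
rewrite [in M y](Q_split y mS) (opD lin) // ripDl.
have -> : rip (M (Q (~` S) y)) (Q S x) = 0.
  by have := cross_form mC dy dx; rewrite setCK.
rewrite addr0 -(Q_sym y _ mS) -sa_sym // [in RHS](Q_split x mS) ripDr.
by rewrite (cross_form mS dy dx) addr0.
Qed.

Lemma form_le S b x : measurable S -> (forall t, S t -> t <= b) -> dom M x ->
  Q S x = x -> rip (M x) x <= b * rip x x.
Proof.
move=> mS Sb dx Sx; have [mu h] := Q_measure x.
rewrite (moment h dx); apply: (first_moment_le (mass_Q h)).
  exact: moment_integrable h dx.
have mN : measurable [set t : R | b < t] by rewrite -set_itvoy.
rewrite (measure_Q h mN) (Q_null mS mN) ?rip0l //.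
by apply/seteqP; split=> // t [/Sb tb /=]; rewrite ltNge tb.
Qed.

Lemma form_ge S a x : measurable S -> (forall t, S t -> a <= t) -> dom M x ->
  Q S x = x -> a * rip x x <= rip (M x) x.
Proof.
move=> mS Sa dx Sx; have [mu h] := Q_measure x.
rewrite (moment h dx); apply: (first_moment_ge (mass_Q h)).
  exact: moment_integrable h dx.
have mN : measurable [set t : R | t < a] by rewrite -set_itvNyo.
rewrite (measure_Q h mN) (Q_null mS mN) ?rip0l //.
by apply/seteqP; split=> // t [/Sa ta /=]; rewrite ltNge ta.
Qed.

Lemma dom_bounded S C x : measurable S -> 0 <= C ->
  (forall t, S t -> `|t| <= C) -> Q S x = x -> dom M x.
Proof.
move=> mS C0 SC Sx; have [mu h] := Q_measure x; have [_ spec] := Q_spec.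
apply: (spec _ _ h).1.2; apply: (second_moment_fin (mass_Q h) C0).
have mN : measurable [set t : R | C < `|t|].
  have -> : [set t : R | C < `|t|] = `]C, +oo[ `|` `]-oo, (- C)[.
    apply/seteqP; split=> t; rewrite /= !in_itv /= andbT ltr_normr.
      by case/orP => lt; [left|right; rewrite ltrNr].
    by case=> lt; rewrite ?lt //; move: lt; rewrite ltrNr => ->; rewrite orbT.
  by apply: measurableU; exact: measurable_itv.
rewrite (measure_Q h mN) (Q_null mS mN) ?rip0l //.
by apply/seteqP; split=> // t [/SC tC /=]; rewrite ltNge tC.
Qed.

End SpectralMeasure.

(** * Resolvent points as lower bounds *)

Section Resolvent.
Variables (R : realType) (H : completeNormedModType R[i]).
Variable ip : {dot H for Num.conj}.
Hypothesis ip_norm : forall x : H, ip x x = `|x| ^+ 2.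
Variable A : operator H.
Hypothesis A_sa : self_adjoint ip A.
Implicit Types (x y : H).

Local Notation rip := (realip ip).
Local Notation shift := (shift A).

Lemma resolventP (z : R[i]) (c : R) : 0 < c ->
  (forall x, dom A x -> c * rnorm x <= rnorm (A x - z *: x)) ->
  (forall y, exists2 x, dom A x & A x - z *: x = y) -> resolvent_set A z.
Proof.
move=> c0 low onto; have lin := sa_lin A_sa; split.
- move=> x y; rewrite !inE => dx dy E.
  have := low _ (domB lin dx dy); rewrite (opB lin) // scalerBr.
  have -> : A x - A y - (z *: x - z *: y) = (A x - z *: x) - (A y - z *: y).
    by apply: (rip_inj ip_norm) => v; rewrite !(ripDl, ripNl); ring.
  move: E => /= ->; rewrite subrr.
  rewrite rnorm0 pmulr_rle0 // => xy; apply/eqP; rewrite -subr_eq0; apply/eqP.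
  by apply: rnorm_eq0; apply/eqP; rewrite eq_le xy rnorm_ge0.
- by apply/seteqP; split=> // y _; have [x dx <-] := onto y; exists x.
- by exists c^-1 => x dx; rewrite ler_pdivlMl // low.
Qed.

Lemma resolvent_real t : resolvent_set A t%:C <-> bounded_below_on A setT t.
Proof.
split=> [[_ _ [K hK]]|low].
  exists (`|K| + 1)^-1 => [|x dx _]; first by rewrite invr_gt0; have := normr_ge0 K; lra.
  rewrite ler_pdivrMl; last by have := normr_ge0 K; lra.
  apply: le_trans (hK x dx) _; rewrite shiftE ler_wpM2r ?rnorm_ge0 //.
  by have := ler_norm K; lra.
have [c c0 lowc] := low; apply: (resolventP c0) => [x dx|y].
  by rewrite -shiftE; exact: lowc.
by have [x dx xE] := shift_onto ip_norm A_sa low y; exists x => //; rewrite -shiftE.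
Qed.

(** <A x, x> is real, so the imaginary part of <(A - w) x, x> is - Im w |x|^2. The bound is proved
    for all w because surjectivity also needs it at the conjugate point. *)
Lemma nonreal_resolvent (z : R[i]) : complex.Im z != 0 -> resolvent_set A z.
Proof.
move=> z0.
have low (w : R[i]) x : dom A x -> `|complex.Im w| * rnorm x <= rnorm (A x - w *: x).
  move=> dx; have [->|x0] := eqVneq x 0; first by rewrite rnorm0 mulr0 rnorm_ge0.
  have rnormi : rnorm ('i *: x) = rnorm x.
    by rewrite rnormZ normc_def /= expr0n expr1n add0r sqrtr1 mul1r.
  rewrite -(ler_pM2r (rnorm_gt0 x0)) -mulrA -expr2 -(ripxx ip_norm) -rnormi.
  apply: le_trans (rip_le_norm ip_norm _ _).
  have xx : ip x x = (rip x x)%:C.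
    by rewrite (ripxx ip_norm) ip_norm normE rmorphXn.
  have Ax : complex.Im (ip (A x) x) = 0.
    have := sa_ip A_sa dx dx; rewrite [RHS](ipC ip).
    by case: (ip (A x) x) => a b [/eqP]; rewrite -addr_eq0 -mulr2n mulrn_eq0 /= => /eqP ->.
  rewrite rip_i ipDl ipNl ipZl xx raddfB /= Ax.
  case: w => a b /=; rewrite !(mulr0, add0r) normrN normrM.
  by rewrite (ger0_norm (rip_ge0 ip_norm x)).
have z1 : 0 < `|complex.Im z| by rewrite normr_gt0.
apply: (resolventP z1) => [x|y]; first exact: low.
apply: (sa_onto ip_norm A_sa z1) => [x|v dv Av]; first exact: low.
have := low z^*%C v dv; rewrite Av subrr rnorm0.
have -> : `|complex.Im z^*%C| = `|complex.Im z| by case: z {z0 z1 Av} => a b /=; rewrite normrN.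
by rewrite pmulr_rle0 // => v0; apply: rnorm_eq0; apply/eqP; rewrite eq_le v0 rnorm_ge0.
Qed.

Lemma normcR (r : R) : `|r%:C| = `|r|%:C.
Proof. by rewrite normc_def /= expr0n addr0 sqrtr_sqr. Qed.

(** No spectrum lies in (g - r, g + r), and the gap inequality at its endpoints expands to |(A - g)
    z|^2 - r^2 |z|^2 >= 0. *)
Lemma dist_low (g r : R) : (r%:E <= dist_to g%:C (spectrum A))%E ->
  forall z, dom A z -> r * rnorm z <= rnorm (shift g z).
Proof.
move=> rd z dz; have [r0|r0] := lerP r 0.
  by apply: le_trans (rnorm_ge0 _); rewrite mulr_le0_ge0 ?rnorm_ge0.
have gap : 0 <= rip (shift (g - r) z) (shift (g + r) z).
  apply: (gap_open ip_norm A_sa) => // [|t t1 t2]; first by lra.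
  apply/resolvent_real; apply: contrapT => tS.
  have : (r%:E <= (complex.Re `|g%:C - t%:C|)%:E)%E.
    by apply: le_trans rd _; apply: ereal_inf_lbound; exists t%:C.
  rewrite -rmorphB normcR lee_fin leNgt => /negP; apply.
  by rewrite ltr_norml; apply/andP; split; lra.
rewrite -(@ler_pXn2r _ 2) ?nnegrE ?mulr_ge0 ?rnorm_ge0 ?(ltW r0) //.
rewrite exprMn -!(ripxx ip_norm).
move: gap; rewrite !shiftE !ripE (ripC _ (A z) z); lra.
Qed.

End Resolvent.

(** * Linearly independent families *)

Section Independence.
Variables (K : fieldType) (V : lmodType K).

Lemma lin_indep_extend (n : nat) (v : 'I_n -> V) (x : V) :
  lin_indep v -> ~ lin_span v x ->
  lin_indep (fun i : 'I_n.+1 => if unlift ord0 i is Some j then v j else x).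
Proof.
move=> v_indep x_span c; rewrite big_ord_recl unlift_none.
under eq_bigr do rewrite liftK.
have [c0|c0] := eqVneq (c ord0) 0; last first.
  move=> E; exfalso; apply: x_span; exists (fun j => - (c ord0)^-1 * c (lift ord0 j)).
  apply: (scalerI c0); rewrite scaler_sumr.
  move/eqP: E; rewrite addr_eq0 => /eqP ->; rewrite -sumrN.
  by apply: eq_bigr => j _; rewrite scalerA mulrA mulrN mulfV // mulN1r scaleNr.
rewrite c0 scale0r add0r => /v_indep cz i.
by have [j ->|->] := unliftP ord0 i.
Qed.

Lemma infinite_lin_indep (W : set V) : W 0 ->
  (forall a x y, W x -> W y -> W (a *: x + y)) ->
  (exists2 x, W x & x != 0) -> ~ (exists n, (0 < n)%N /\ has_dim W n) ->
  forall n, exists v : 'I_n -> V, lin_indep v /\ forall i, W (v i).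
Proof.
move=> W0 WD [x0 Wx0 x0_neq0] inf; elim=> [|n [v [v_indep Wv]]].
  exists (fun=> 0); split=> [c _ []|[]] //.
have span_sub : lin_span v `<=` W.
  move=> _ [c ->]; elim/big_rec: _ => // i x _; exact: WD.
have [x Wx vx] : exists2 x, W x & ~ lin_span v x.
  apply: contrapT => no; have WE : W = lin_span v.
    apply/seteqP; split=> // x Wx; apply: contrapT => vx.
    by apply: no; exists x.
  (* The hypothesis excludes positive dimensions only; dimension 0 is excluded by x0. *)
  case: n v v_indep Wv span_sub no WE => [|n] v v_indep Wv span_sub no WE.
    have [c] : lin_span v x0 by rewrite -WE.
    by rewrite big_ord0 => x00; move: x0_neq0; rewrite x00 eqxx.
  by apply: inf; exists n.+1; split=> //; exists v.
exists (fun i : 'I_n.+1 => if unlift ord0 i is Some j then v j else x); split.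
  exact: lin_indep_extend.
by move=> i; case: unlift.
Qed.

End Independence.

(** * Spectral subspaces and the spectrum *)

Section SpectralSubspaces.
Variables (R : realType) (H : completeNormedModType R[i]).
Variable ip : {dot H for Num.conj}.
Hypothesis ip_norm : forall x : H, ip x x = `|x| ^+ 2.
Variable M : operator H.
Hypothesis M_sa : self_adjoint ip M.
Variable Q : set R -> {linear H -> H}.
Hypothesis Q_spec : spectral_measure ip M Q.
Implicit Types (S T : set R) (x y : H).

Local Notation rip := (realip ip).
Local Notation shift := (shift M).

Let mitv (i : interval R) : measurable [set` i]. Proof. exact: measurable_itv. Qed.

Lemma Q_orth S T x y : measurable S -> measurable T -> S `&` T = set0 ->
  rip (Q S x) (Q T y) = 0.
Proof.
by move=> mS mT ST; rewrite (Q_sym Q_spec) // (Q_disjoint ip_norm Q_spec) // rip0r.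
Qed.

(** x splits into a part a below and a part b above the window; pairing (M - w) x with b - a, which
    has the norm of x, gives at least e |x|^2. *)
Lemma empty_gap w e : 0 < e -> (forall x, Q `]w - e, w + e[ x = 0) ->
  bounded_below_on M setT w.
Proof.
move=> e0 empty; have lin := sa_lin M_sa; exists e => // x dx _.
pose a := Q `]-oo, w - e] x; pose b := Q `[w + e, +oo[ x.
have disj : [set` `]-oo, w - e]] `&` [set` `[w + e, +oo[] = set0 :> set R.
  by apply/seteqP; split=> // t; rewrite /= !in_itv /= andbT => -[]; lra.
have xE : x = a + b.
  rewrite {1}[x](Q_split ip_norm Q_spec x (mitv `]-oo, w - e])) -/a; congr (_ + _).
  have -> : ~` [set` `]-oo, w - e]] = `]w - e, w + e[ `|` `[w + e, +oo[ :> set R.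
    apply/seteqP; split=> t; rewrite /= !in_itv /= andbT.
      move/negP; rewrite -ltNge => -> /=; have [|] := ltP t (w + e); by [left|right].
    by case=> [/andP[]|] h; [move=> ?|]; apply/negP; rewrite -ltNge //; lra.
  rewrite (Q_U ip_norm Q_spec) ?empty ?add0r //.
  by apply/seteqP; split=> // t; rewrite /= !in_itv /= andbT => -[/andP[]]; lra.
have da : dom M a by apply: (dom_Q ip_norm Q_spec).
have db : dom M b by apply: (dom_Q ip_norm Q_spec).
have Qa : Q `]-oo, w - e] a = a by apply: (QQ Q_spec).
have Qb : Q `[w + e, +oo[ b = b by apply: (QQ Q_spec).
have ab : rip a b = 0 by apply: Q_orth.
have ha : rip (M a) a <= (w - e) * rip a a.
  by apply: (form_le ip_norm Q_spec _ _ da Qa) => // t; rewrite /= in_itv.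
have hb : (w + e) * rip b b <= rip (M b) b.
  by apply: (form_ge ip_norm Q_spec _ _ db Qb) => // t; rewrite /= in_itv /= andbT.
have shiftx : shift w x = shift w a + shift w b.
  by rewrite xE; have := shiftP ip_norm M_sa w 1 da db; rewrite !scale1r.
clearbody a b.
have [->|x0] := eqVneq x 0; first by rewrite rnorm0 mulr0 rnorm_ge0.
rewrite -(ler_pM2r (rnorm_gt0 x0)) -mulrA -expr2 -(ripxx ip_norm).
have -> : rnorm x = rnorm (b - a).
  apply/eqP; rewrite -(@eqrXn2 _ 2) ?rnorm_ge0 // -!(ripxx ip_norm).
  by rewrite xE !ripE (ripC _ b a) ab; apply/eqP; ring.
apply: le_trans (rip_le ip_norm _ _).
rewrite shiftx xE !shiftE !ripE (ripC _ b a) ab (sa_sym M_sa db da) (ripC _ b).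
lra.
Qed.

(** On the window the form of M - w is at most e in absolute value, and for a symmetric operator
    polarization turns a form bound into a norm bound. Commutation keeps (M - w) x in the window. *)
Lemma norm_le_window w e x : 0 < e -> Q `]w - e, w + e[ x = x ->
  dom M x /\ rnorm (shift w x) <= e * rnorm x.
Proof.
move=> e0 Qx; have lin := sa_lin M_sa.
pose I : set R := `]w - e, w + e[%classic.
have mI : measurable I by exact: mitv.
have C0 : 0 <= `|w| + e by rewrite addr_ge0 // ltW.
have IC t : I t -> `|t| <= `|w| + e.
  rewrite /I /= in_itv /= => /andP[t1 t2]; have := ler_norm w; have := ler_norm (- w).
  by rewrite normrN ler_norml => h1 h2; apply/andP; split; lra.
have dI y : Q I y = y -> dom M y by exact: (dom_bounded ip_norm Q_spec mI C0 IC).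
have dx := dI x Qx; split=> //.
pose n y := rip (M y) y - w * rip y y.
have n_le y : Q I y = y -> `|n y| <= e * rip y y.
  move=> Qy; have dy := dI y Qy; rewrite /n ler_norml; apply/andP; split.
    have := form_ge ip_norm Q_spec mI (a := w - e) _ dy Qy; rewrite mulrBl => h.
    have : (w * rip y y - e * rip y y) <= rip (M y) y; last by lra.
    by apply: h => t; rewrite /I /= in_itv /= => /andP[/ltW].
  have := form_le ip_norm Q_spec mI (b := w + e) _ dy Qy; rewrite mulrDl => h.
  have : rip (M y) y <= (w * rip y y + e * rip y y); last by lra.
  by apply: h => t; rewrite /I /= in_itv /= => /andP[_ /ltW].
pose u := shift w x.
have Qu : Q I u = u.
  by rewrite /u shiftE raddfB /= linearZ_LR /= -(Q_comm ip_norm M_sa Q_spec) // Qx.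
have du := dI u Qu.
(* The scaling 1/e balances |x|^2 and |y|^2, so that no constant is lost in the polarization. *)
pose y := (e^-1)%:C *: u.
have Qy : Q I y = y by rewrite /y linearZ_LR /= Qu.
have dy := dI y Qy.
have h1 := n_le (x + y); have h2 := n_le (x - y).
have Qp : Q I (x + y) = x + y by rewrite raddfD /= Qx Qy.
have Qm : Q I (x - y) = x - y by rewrite raddfB /= Qx Qy.
have {h1}h1 := le_trans (ler_norm _) (h1 Qp).
have {h2}h2 : - n (x - y) <= e * rip (x - y) (x - y).
  by apply: le_trans (h2 Qm); rewrite -normrN ler_norm.
have polar : n (x + y) - n (x - y) = 4 / e * rip u u.
  rewrite /n (opD lin) // (opB lin) // /y (opZ lin) // !ripE (sa_sym M_sa du dx).
  have uE : rip u u = rip u (M x) - w * rip u x by rewrite {2}/u shiftE !ripE.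
  by rewrite uE (ripC _ (M x) u) (ripC _ x u); ring.
have sq : rip (x + y) (x + y) + rip (x - y) (x - y) = 2 * rip x x + 2 / e ^+ 2 * rip u u.
  by rewrite /y !ripE; field; rewrite gt_eqF.
rewrite -(@ler_pXn2r _ 2) ?nnegrE ?mulr_ge0 ?rnorm_ge0 ?(ltW e0) //.
rewrite exprMn -!(ripxx ip_norm) -/u.
have : 4 / e * rip u u <= e * (2 * rip x x + 2 / e ^+ 2 * rip u u).
  by rewrite -polar -sq; lra.
have -> : 4 / e * rip u u = 2 / e * rip u u + 2 / e * rip u u by field; rewrite gt_eqF.
have -> : e * (2 * rip x x + 2 / e ^+ 2 * rip u u) = 2 / e * (e ^+ 2 * rip x x) + 2 / e * rip u u.
  by field; rewrite gt_eqF.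
by rewrite lerD2r ler_pM2l // divr_gt0.
Qed.

Lemma window_eq0 g b e : 0 < e -> e < b ->
  (forall z, dom M z -> b * rnorm z <= rnorm (shift g z)) ->
  forall S x, measurable S -> S `<=` `]g - e, g + e[ -> Q S x = 0.
Proof.
move=> e0 eb low S x mS SI.
have Qy : Q `]g - e, g + e[ (Q S x) = Q S x.
  by apply: (Q_subset ip_norm Q_spec mS _ SI) => //; exact: (QQ Q_spec).
have [dy le_y] := norm_le_window e0 Qy.
apply: rnorm_eq0; apply/eqP; rewrite eq_le rnorm_ge0 andbT.
have : (b - e) * rnorm (Q S x) <= 0 by rewrite mulrBl subr_le0 (le_trans (low _ dy)).
by rewrite pmulr_rle0 // subr_gt0.
Qed.

(** The projection onto (g - (b - e), g] vanishes by [window_eq0], which needs a radius strictly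
    below b; then e tends to 0. *)
Lemma form_below g b : 0 <= b ->
  (forall z, dom M z -> b * rnorm z <= rnorm (shift g z)) ->
  forall z, dom M z -> Q `]-oo, g] z = z -> rip (M z) z <= (g - b) * rip z z.
Proof.
move=> b0 low z dz Qz; apply: (@eps_le _ _ _ (rip z z)) => e e0.
have le_g : rip (M z) z <= g * rip z z.
  by apply: (form_le ip_norm Q_spec _ _ dz Qz) => // t; rewrite /= in_itv.
have zz := rip_ge0 ip_norm z.
have [be|eb] := lerP b e; first by nra.
have e'0 : 0 < b - e by rewrite subr_gt0.
have e'b : b - e < b by rewrite ltrBlDr ltrDl.
have Qz' : Q `]-oo, g - (b - e)] z = z.
  rewrite -[RHS]Qz.
  have -> : `]-oo, g]%classic = `]-oo, g - (b - e)] `|` `]g - (b - e), g] :> set R.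
    apply/seteqP; split=> t; rewrite /= !in_itv /=.
      by move=> tg; have [?|?] := lerP t (g - (b - e)); [left|right; apply/andP].
    by case=> [|/andP[]] //; lra.
  rewrite (Q_U ip_norm Q_spec) //; last first.
    by apply/seteqP; split=> // t; rewrite /= !in_itv /= => -[] ? /andP[]; lra.
  have -> : Q `]g - (b - e), g] z = 0; last by rewrite addr0.
  apply: (window_eq0 e'0 e'b low) => // t.
  by rewrite /= !in_itv /= => /andP[? ?]; apply/andP; split; lra.
have : rip (M z) z <= (g - (b - e)) * rip z z; last by lra.
by apply: (form_le ip_norm Q_spec _ _ dz Qz') => // t; rewrite /= in_itv.
Qed.

Lemma form_above g b : 0 <= b ->
  (forall z, dom M z -> b * rnorm z <= rnorm (shift g z)) ->
  forall z, dom M z -> Q `]g, +oo[ z = z -> (g + b) * rip z z <= rip (M z) z.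
Proof.
move=> b0 low z dz Qz; apply: (@eps_le _ _ _ (rip z z)) => e e0.
have ge_g : g * rip z z <= rip (M z) z.
  by apply: (form_ge ip_norm Q_spec _ _ dz Qz) => // t; rewrite /= in_itv /= andbT => /ltW.
have zz := rip_ge0 ip_norm z.
have [be|eb] := lerP b e; first by nra.
have e'0 : 0 < b - e by rewrite subr_gt0.
have e'b : b - e < b by rewrite ltrBlDr ltrDl.
have Qz' : Q `[g + (b - e), +oo[ z = z.
  rewrite -[RHS]Qz.
  have -> : `]g, +oo[%classic = `]g, g + (b - e)[ `|` `[g + (b - e), +oo[ :> set R.
    apply/seteqP; split=> t; rewrite /= !in_itv /= !andbT.
      by move=> gt_; have [?|?] := lerP (g + (b - e)) t; [right|left; apply/andP].
    by case=> [/andP[]|] //; lra.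
  rewrite (Q_U ip_norm Q_spec) //; last first.
    by apply/seteqP; split=> // t; rewrite /= !in_itv /= andbT => -[] /andP[]; lra.
  have -> : Q `]g, g + (b - e)[ z = 0; last by rewrite add0r.
  apply: (window_eq0 e'0 e'b low) => // t.
  by rewrite /= !in_itv /= => /andP[? ?]; apply/andP; split; lra.
have : (g + (b - e)) * rip z z <= rip (M z) z; last by lra.
by apply: (form_ge ip_norm Q_spec _ _ dz Qz') => // t; rewrite /= in_itv /= andbT.
Qed.

(** By commutation every Q S x satisfies the eigenvalue equation for t, which the form bounds on
    (-oo, a] and (b, +oo) allow only for the zero vector. *)
Lemma eigenvector_window a b t x : a < t -> t < b -> eigenspace_op M t%:C x ->
  Q `]a, b] x = x.
Proof.
move=> at_ tb [dx Mx].
have rMx S : measurable S -> rip (M (Q S x)) (Q S x) = t * rip (Q S x) (Q S x).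
  by move=> mS; rewrite (Q_comm ip_norm M_sa Q_spec) // Mx linearZ_LR /= ripZl.
have dQ S : measurable S -> dom M (Q S x) by move=> mS; exact: (dom_Q ip_norm Q_spec).
have low0 : Q `]-oo, a] x = 0.
  apply: (rip_eq0 ip_norm); apply/eqP; rewrite eq_le rip_ge0 // andbT.
  have : t * rip (Q `]-oo, a] x) (Q `]-oo, a] x) <=
         a * rip (Q `]-oo, a] x) (Q `]-oo, a] x).
    rewrite -rMx //; apply: (form_le ip_norm Q_spec (mitv `]-oo, a])) => [s||].
    - by rewrite /= in_itv.
    - exact: dQ.
    - exact: (QQ Q_spec).
  by rewrite -subr_ge0 -mulrBl nmulr_rge0 // subr_lt0.
have high0 : Q `]b, +oo[ x = 0.
  apply: (rip_eq0 ip_norm); apply/eqP; rewrite eq_le rip_ge0 // andbT.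
  have : b * rip (Q `]b, +oo[ x) (Q `]b, +oo[ x) <=
         t * rip (Q `]b, +oo[ x) (Q `]b, +oo[ x).
    rewrite -rMx //; apply: (form_ge ip_norm Q_spec (mitv `]b, +oo[)) => [s||].
    - by rewrite /= in_itv /= andbT => /ltW.
    - exact: dQ.
    - exact: (QQ Q_spec).
  by rewrite -subr_ge0 -mulrBl nmulr_rge0 // subr_lt0.
rewrite [RHS](Q_split ip_norm Q_spec x (mitv `]-oo, a])) low0 add0r.
have -> : ~` [set` `]-oo, a]] = `]a, b] `|` `]b, +oo[ :> set R.
  apply/seteqP; split=> s; rewrite /= !in_itv /= andbT.
    by move/negP; rewrite -ltNge => -> /=; have [|] := lerP s b; by [left|right].
  by case=> [/andP[]|] h; [move=> ?|]; apply/negP; rewrite -ltNge //; lra.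
rewrite (Q_U ip_norm Q_spec) // ?high0 ?addr0 //.
by apply/seteqP; split=> // s; rewrite /= !in_itv /= andbT => -[/andP[]]; lra.
Qed.

(** A point fails to be discrete in two ways. If l is isolated, it is an eigenvalue of infinite
    multiplicity and eigenvectors serve; otherwise spectral points accumulate at l, and vectors from
    disjoint windows around them serve. *)
Lemma essential_indep g l b : g < l -> l < b -> essential_spectrum M l%:C ->
  forall n, exists v : 'I_n -> H, lin_indep v /\ forall i, Q `]g, b] (v i) = v i.
Proof.
move=> gl lb [spec_l not_disc] n; have lin := sa_lin M_sa.
have [[e e0 iso]|not_iso] := pselect (exists2 e : R, 0 < e &
    forall w, spectrum M w -> `|w - l%:C| < e%:C -> w = l%:C).
  pose W := eigenspace_op M l%:C.
  have low : bounded_below_on M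
      [set x | forall v, dom M v -> M v = l%:C *: v -> rip x v = 0] l.
    apply: (isolated_bounded_below ip_norm M_sa e0) => s s1 s2 sl.
    apply/(resolvent_real ip_norm M_sa); apply: contrapT => spec_s.
    move: sl; have /(congr1 (@complex.Re R)) /= -> : s%:C = l%:C; last by rewrite eqxx.
    apply: iso => //; rewrite -rmorphB normcR ltcR ltr_norml.
    by apply/andP; split; lra.
  (* Without an eigenvector the lower bound off the eigenspace would hold everywhere, making l a
     resolvent point. *)
  have [x0 [dx0 Mx0] x0_neq0] : exists2 x, W x & x != 0.
    apply: contrapT => no; apply: spec_l; apply/(resolvent_real ip_norm M_sa).
    have [c c0 lowc] := low; exists c => // x dx _; apply: lowc => // v dv Mv.
    have [->|v0] := eqVneq v 0; first by rewrite rip0r.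
    by exfalso; apply: no; exists v.
  have [v [v_indep Wv]] : exists v : 'I_n -> H, lin_indep v /\ forall i, W (v i).
    apply: infinite_lin_indep.
    - by split; [exact: dom0|rewrite (op0 lin) scaler0].
    - move=> a x y [dx Mx] [dy My]; split; first exact: domP.
      by rewrite (opP lin) // Mx My scalerDr !scalerA mulrC.
    - by exists x0.
    - move=> [k [k0 dimW]]; apply: not_disc; split=> //; first by exists e.
      by exists k.
  by exists v; split=> // i; apply: eigenvector_window (Wv i).
suff [S [mS SI [v [v_indep Qv]]]] : exists S, [/\ measurable S, S `<=` `]g, b]
    & exists v : 'I_n -> H, lin_indep v /\ forall i, Q S (v i) = v i].
  by exists v; split=> // i; apply: (Q_subset ip_norm Q_spec mS _ SI).
(* The inner radius d is recorded so that the next spectral point can be sought inside it, with a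
   window disjoint from S. *)
suff key : forall e, 0 < e -> exists d S, [/\ 0 < d, d < e, measurable S,
    forall s, S s -> d <= `|s - l| /\ `|s - l| < e &
    exists v : 'I_n -> H, lin_indep v /\ forall i, Q S (v i) = v i].
  have [|d [S [_ _ mS SI hv]]] := key (Num.min (l - g) (b - l)).
    by rewrite lt_min !subr_gt0 gl.
  exists S; split=> // s /SI[_]; rewrite lt_min ltr_norml => /andP[/andP[h1 _]].
  by rewrite ltr_norml => /andP[_ h2] /=; rewrite in_itv /=; apply/andP; split; lra.
elim: n => [|n IH] e e0.
  exists (e / 2), set0; split=> //; [by lra|by lra|].
  by exists (fun=> 0); split=> [c _ []|[]].
have [d [S [d0 de mS SI [v [v_indep Qv]]]]] := IH e e0.
have [w spec_w [wl wd]] : exists2 w, spectrum M w & `|w - l%:C| < d%:C /\ w <> l%:C.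
  apply: contrapT => no; apply: not_iso; exists d => // w spec_w wd.
  by apply: contrapT => wl; apply: no; exists w.
have wR : w = (complex.Re w)%:C.
  have [w0|w0] := eqVneq (complex.Im w) 0; first by case: w w0 {spec_w wl wd} => ? ? /= ->.
  by exfalso; apply: spec_w; exact: (nonreal_resolvent ip_norm M_sa).
move: (complex.Re w) wR => t wt; rewrite {w}wt in spec_w wl wd.
move: wl; rewrite -rmorphB normcR ltcR => wl.
have tl : 0 < `|t - l|.
  by rewrite normr_gt0 subr_eq0; apply/eqP => tl; apply: wd; rewrite tl.
(* Half of each margin keeps the window around t off l and inside the radius d. *)
pose r := Num.min `|t - l| (d - `|t - l|) / 2.
have rt : r <= `|t - l| / 2 by rewrite ler_pM2r ?invr_gt0 // ge_min lexx.
have rd : r <= (d - `|t - l|) / 2 by rewrite ler_pM2r ?invr_gt0 // ge_min lexx orbT.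
have r0 : 0 < r by rewrite divr_gt0 // lt_min tl subr_gt0.
pose T : set R := `]t - r, t + r[%classic.
have mT : measurable T by exact: mitv.
have TI s : T s -> `|t - l| - r <= `|s - l| /\ `|s - l| < d.
  rewrite /T /= in_itv /= => /andP[s1 s2].
  have st : `|s - t| < r by rewrite ltr_norml; apply/andP; split; lra.
  have h1 : `|t - l| <= `|s - t| + `|s - l|.
    by rewrite (distrC s t); apply: le_trans (ler_normD _ _); rewrite subrKA.
  have h2 : `|s - l| <= `|s - t| + `|t - l|.
    by apply: le_trans (ler_normD _ _); rewrite subrKA.
  by split; lra.
have ST0 : S `&` T = set0.
  by apply/seteqP; split=> // s [/SI[h1 _] /TI[_ h2]]; move: h1; rewrite leNgt h2.
have [x Qx x0] : exists2 x, Q T x = x & x <> 0.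
  apply: contrapT => no; apply: spec_w; apply/(resolvent_real ip_norm M_sa).
  apply: (empty_gap r0) => x; apply: contrapT => Tx; apply: no.
  by exists (Q T x) => //; exact: (QQ Q_spec).
have mU : measurable (S `|` T) by exact: measurableU.
exists (`|t - l| - r), (S `|` T); split=> //.
- by lra.
- by lra.
- by move=> s [/SI[h1 h2]|/TI[h1 h2]]; split=> //; lra.
exists (fun i : 'I_n.+1 => if unlift ord0 i is Some j then v j else x); split.
  apply: lin_indep_extend => // -[c xE]; apply: x0.
  have Sx : Q S x = x.
    rewrite xE raddf_sum; apply: eq_bigr => i _ /=. by rewrite -[in RHS]Qv; exact: linearZ_LR.
  by rewrite -Sx -Qx (Q_disjoint ip_norm Q_spec).
move=> i; case: unlift => [j|].
  by apply: (Q_subset ip_norm Q_spec mS mU _ (Qv j)); exact: subsetUl.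
by apply: (Q_subset ip_norm Q_spec mT mU _ Qx); exact: subsetUr.
Qed.

End SpectralSubspaces.

(** * Eigenvalue enumerations *)

Section Eigenvalues.
Variables (R : realType) (H : completeNormedModType R[i]).
Variable ip : {dot H for Num.conj}.
Hypothesis ip_norm : forall x : H, ip x x = `|x| ^+ 2.
Variable A : operator H.
Hypothesis A_sa : self_adjoint ip A.
Variables (gamma : R) (l : nat -> \bar R).
Hypothesis l_enum : eigenvalue_enumeration A gamma l.
Implicit Types (x y z : H) (t : R).

Local Notation rip := (realip ip).
Local Notation shift := (shift A).
Local Notation eig := (eigenspace_op A).

Lemma ip_eigen t x y : dom A x -> eig t%:C y -> ip (A x) y = t%:C * ip x y.
Proof.
by move=> dx [dy Ay]; rewrite (sa_ip A_sa) // Ay ipZr conjc_real.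
Qed.

Lemma eigen_orth s t x y : s != t -> eig s%:C x -> eig t%:C y -> ip x y = 0.
Proof.
move=> st ex ey; have [dx Ax] := ex; have := ip_eigen dx ey.
rewrite Ax ipZl => /eqP; rewrite -subr_eq0 -mulrBl mulf_eq0 -rmorphB.
by rewrite fmorph_eq0 subr_eq0 (negbTE st) /= => /eqP.
Qed.

Lemma eigen_not_bounded_below t x : x != 0 -> eig t%:C x -> forall s c,
  (forall y, dom A y -> setT y -> c * rnorm y <= rnorm (shift s y)) -> c <= `|t - s|.
Proof.
move=> x0 [dx Ax] s c low; have := low x dx I.
rewrite shiftE Ax -scalerBl -rmorphB rnormZR ler_pM2r //; exact: rnorm_gt0.
Qed.

(* The indices j with l j = t label a basis of the eigenspace of t. *)
Definition labels t (b : nat -> H) : Prop :=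
  [/\ forall j, l j = t%:E -> eig t%:C (b j),
      forall x y, eig t%:C x -> (forall j, l j = t%:E -> ip y (b j) = 0) -> ip y x = 0 &
      forall N (c : nat -> R[i]), \sum_(j < N | l j == t%:E) c j *: b j = 0 ->
        forall j, (j < N)%N -> l j = t%:E -> c j = 0].

(** The enumeration provides only a cardinality; a bijection f from the indices with value t onto
    'I_n carries a basis of the eigenspace over to them. *)
Lemma labels_exist t : gamma < t -> (t%:E < lambda_inf A gamma)%E ->
  exists b, labels t b.
Proof.
move=> gt_ tl; have [_ _ /(_ t gt_ tl) [n [[v [v_indep vE]]]]] := l_enum.
move=> /card_set_bijP[f [f_homo f_inj f_surj]].
pose b j := if insub (f j) is Some i then v i else 0 : H.
have bE j (i : 'I_n) : f j = i :> nat -> b j = v i.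
  move=> fj; rewrite /b; case: insubP => [i' _ i'E|]; last by rewrite fj ltn_ord.
  by congr v; apply: val_inj; rewrite i'E.
have f_lt j : l j = t%:E -> (f j < n)%N by move=> lj; exact: f_homo.
exists b; split.
- move=> j lj; rewrite (bE j (Ordinal (f_lt j lj))) // vE.
  exists (fun i => (i == Ordinal (f_lt j lj))%:R).
  rewrite (bigD1 (Ordinal (f_lt j lj))) //= eqxx scale1r big1 ?addr0 //.
  by move=> i /negbTE ->; rewrite scale0r.
- move=> x y; rewrite vE => -[c ->] y_orth.
  apply: (@sum_subspace R[i] H (fun z => ip y z = 0)) => [|a u w yu yw|i].
  + by rewrite -(scale0r 0) ipZr conjc0 mul0r.
  + by rewrite ipDr ipZr yu yw mulr0 addr0.
  + have [j /= lj fj] : ((f @` [set k | l k = t%:E]) : set nat) i.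
      by apply: f_surj; exact: ltn_ord.
    by rewrite -(bE j i fj); exact: y_orth.
move=> N c sum0 j jN lj.
pose c' (i : 'I_n) := \sum_(j < N | (l j == t%:E) && (f j == i :> nat)) c j.
have : \sum_i c' i *: v i = 0.
  rewrite -[RHS]sum0.
  rewrite (partition_big (fun j : 'I_N => insubd (Ordinal (f_lt _ lj)) (f j)) xpredT) //=.
  apply: eq_bigr => i _; rewrite scaler_suml.
  apply: eq_big => [j'|j' /andP[/eqP lj' /eqP fj']]; last by rewrite (bE j' i).
  case: eqP => //= lj'; rewrite -val_eqE /= val_insubd f_lt //.
move=> /v_indep /(_ (Ordinal (f_lt _ lj))); rewrite /c' => c'0.
rewrite -[RHS]c'0 (bigD1 (Ordinal jN)) /=; last by rewrite lj !eqxx.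
rewrite big1 ?addr0 // => j' /andP[/andP[/eqP lj' /eqP fj'] /negP j'j].
exfalso; apply: j'j; rewrite -val_eqE /=; apply/eqP.
by apply: f_inj; rewrite ?inE.
Qed.

Lemma labelling : exists b, forall t, gamma < t -> (t%:E < lambda_inf A gamma)%E ->
  labels t b.
Proof.
have ex t : exists b, gamma < t -> (t%:E < lambda_inf A gamma)%E -> labels t b.
  have [[gt_ tl]|no] := pselect (gamma < t /\ (t%:E < lambda_inf A gamma)%E).
    by have [b hb] := labels_exist gt_ tl; exists b.
  by exists (fun=> 0) => ? ?; exfalso; apply: no.
have [B hB] := choice ex.
(* One family for all eigenvalues: index j consults the labelling chosen for its own value l j. *)
exists (fun j => B (fine (l j)) j) => t gt_ tl.
have [h1 h2 h3] := hB t gt_ tl; split.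
- by move=> j lj; rewrite lj; exact: h1.
- by move=> x y ex_ h; apply: h2 => // j lj; have := h j lj; rewrite lj.
move=> N c sum0; apply: h3; rewrite -[RHS]sum0.
by apply: eq_bigr => j /eqP ->.
Qed.

Lemma enum_lt_inf j : (l j < lambda_inf A gamma)%E ->
  exists t, [/\ gamma < t, (t%:E < lambda_inf A gamma)%E & l j = t%:E].
Proof.
have [_ /(_ j) [->|[t [? ? _ ?]]] _] := l_enum; first by rewrite ltxx.
by move=> _; exists t.
Qed.

(** In a vanishing combination the part s belonging to one eigenvalue is orthogonal to the rest,
    hence to itself; inside one eigenspace [labels] gives independence. *)
Lemma eigenvectors_indep (k : nat) : (l k < lambda_inf A gamma)%E ->
  exists w : 'I_k.+1 -> H, lin_indep w /\
    forall i, exists t, [/\ gamma < t, (t%:E <= l k)%E & eig t%:C (w i)].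
Proof.
move=> lk; have [l_mono _ _] := l_enum; have [b hb] := labelling.
have l_real j : (j <= k)%N -> exists t, [/\ gamma < t, (t%:E < lambda_inf A gamma)%E & l j = t%:E].
  by move=> jk; apply: enum_lt_inf; apply: le_lt_trans lk; exact: l_mono.
exists (fun j => b j); split; last first.
  move=> i; have [|t [gt_ tl lt_]] := @l_real i; first by rewrite -ltnS.
  exists t; split=> //; first by rewrite -lt_ l_mono // -ltnS.
  by have [h _ _] := hb t gt_ tl; exact: h.
move=> c sum0 i0; have [|t [gt_ tl li0]] := @l_real i0; first by rewrite -ltnS.
have [h1 h2 h3] := hb t gt_ tl.
pose c' (j : nat) := c (inord j).
have cE (i : 'I_k.+1) : c' i = c i by rewrite /c' inord_val.
rewrite -cE; apply: (h3 k.+1) => //.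
set s := \sum_(j < k.+1 | _) _.
have es : eig t%:C s.
  rewrite /s; elim/big_rec: _ => [|j x /eqP lj [dx Ax]].
    by split; [exact: (dom0 (sa_lin A_sa))|rewrite (op0 (sa_lin A_sa)) scaler0].
  have [db Ab] := h1 j lj; split; first exact: (domP (sa_lin A_sa)).
  by rewrite (opP (sa_lin A_sa)) // Ab Ax scalerDr !scalerA mulrC.
have rest0 : ip s (\sum_(j < k.+1 | l j != t%:E) c' j *: b j) = 0.
  elim/big_rec: _ => [|j x lj sx]; first by rewrite -(scale0r 0) ipZr conjc0 mul0r.
  rewrite ipDr ipZr sx addr0.
  have [|u [gu ul lju]] := @l_real j; first by rewrite -ltnS.
  have [hu _ _] := hb u gu ul.
  rewrite (@eigen_orth t u) ?mulr0 //; last exact: hu.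
  by apply: contra lj => /eqP ->; rewrite lju.
apply: (rip_eq0 ip_norm); rewrite /realip.
have tot : s + \sum_(j < k.+1 | l j != t%:E) c' j *: b j = 0.
  rewrite -[RHS]sum0 [in RHS](bigID (fun j : 'I_k.+1 => l j == t%:E)) /=.
  by congr (_ + _); apply: eq_bigr => j _; rewrite cE.
have -> : ip s s = ip s (s + \sum_(j < k.+1 | l j != t%:E) c' j *: b j).
  by rewrite ipDr rest0 addr0.
by rewrite tot -(scale0r 0) ipZr conjc0 mul0r.
Qed.

Lemma lambda_inf_ge : (gamma%:E <= lambda_inf A gamma)%E.
Proof.
apply: le_ereal_inf_tmp => _ [t [gt_ _] <-]; rewrite lee_fin; exact: ltW.
Qed.

Lemma not_essential t : gamma < t -> (t%:E < lambda_inf A gamma)%E ->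
  spectrum A t%:C -> discrete_spectrum A t%:C.
Proof.
move=> gt_ tl st; apply: contrapT => nd.
have : (lambda_inf A gamma <= t%:E)%E by apply: ereal_inf_lbound; exists t.
by rewrite leNgt tl.
Qed.

Hypothesis gamma_res : resolvent_set A gamma%:C.

(** A lower bound c at gamma leaves c - |t - gamma| at t, so (gamma, gamma + c) contains no
    spectrum. *)
Lemma lambda_inf_gt : (gamma%:E < lambda_inf A gamma)%E.
Proof.
have [c c0 low] := (resolvent_real ip_norm A_sa gamma).1 gamma_res.
apply: lt_le_trans (_ : (gamma + c)%:E <= _)%E; first by rewrite lte_fin ltrDl.
apply: le_ereal_inf_tmp => _ [t [gt_ [st _]] <-]; rewrite lee_fin leNgt; apply/negP => tc.
apply: st; apply/(resolvent_real ip_norm A_sa).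
exists (c - (t - gamma)); first by lra.
move=> x dx _; have := low x dx I.
rewrite (shift_shift ip_norm A gamma t) mulrBl => h.
have := le_trans h (rnormD _ _); rewrite rnormZR gtr0_norm ?subr_gt0 //; lra.
Qed.

Lemma enum_gt k : (gamma%:E < l k)%E.
Proof.
have [_ /(_ k) [->|[t [gt_ _ _ ->]]] _] := l_enum; first exact: lambda_inf_gt.
by rewrite lte_fin.
Qed.

Lemma enum_le_inf k : (l k <= lambda_inf A gamma)%E.
Proof. by have [_ /(_ k) [->|[t [_ /ltW tl _ ->]]] _] := l_enum. Qed.

(** Delivers the premises [gap] and [onto] of [subspace_contradiction]. Spectrum in (gamma, mu) is
    discrete, and since mu < l k its eigenvectors all carry labels below k. *)
Lemma complement_gap k (mu : R) : gamma < mu -> (mu%:E < l k)%E ->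
  exists v : 'I_k -> H,
    (forall z, dom A z -> (forall j, ip z (v j) = 0) ->
       0 <= rip (shift gamma z) (shift mu z)) /\
    (forall x, (forall j, ip x (v j) = 0) ->
       exists z, [/\ dom A z, shift gamma z = x & forall j, ip z (v j) = 0]).
Proof.
move=> gm mk; have [l_mono _ _] := l_enum; have [b hb] := labelling.
have lin := sa_lin A_sa.
have low := (resolvent_real ip_norm A_sa gamma).1 gamma_res.
(* Indices filled in by [lambda_inf] get 0, which imposes no condition; as 0 solves every eigenvalue
   equation, gamma + 1 serves as its value different from gamma. *)
pose v (j : 'I_k) := if (l j < lambda_inf A gamma)%E then b j else 0.
have v_eig j : exists2 t, t != gamma & eig t%:C (v j).
  rewrite /v; case: ifPn => [/enum_lt_inf[t [gt_ tl lj]]|_].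
    by exists t; [rewrite gt_eqF|have [h _ _] := hb t gt_ tl; exact: h].
  exists (gamma + 1); first by rewrite gt_eqF // ltrDl.
  by split; [exact: dom0|rewrite (op0 lin) scaler0].
pose K := [set x | forall j, ip x (v j) = 0].
have Ksub : real_subspace K.
  split=> [j|r x y Kx Ky j]; first by rewrite -(scale0r 0) ipZl mul0r.
  by rewrite ipDl ipZl Kx Ky mulr0 addr0.
have Kinv z : dom A z -> K (shift gamma z) -> K z.
  move=> dz Kz j; have [t tg et] := v_eig j; have := Kz j.
  rewrite shiftE ipDl ipNl ipZl (ip_eigen dz et) -mulrBl -rmorphB => /eqP.
  by rewrite mulf_eq0 fmorph_eq0 subr_eq0 (negbTE tg) => /eqP.
exists v; split; last first.
  move=> x Kx; have [z dz zx] := shift_onto ip_norm A_sa low x.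
  by exists z; split=> //; apply: Kinv => //; rewrite zx.
move=> z dz Kz; apply: (gap_right ip_norm A_sa Ksub) => //.
  move=> y dy Ky j; have [t _ et] := v_eig j.
  by rewrite (ip_eigen dy et) Ky mulr0.
move=> t gt_ tm.
have tk : (t%:E < l k)%E by apply: lt_trans mk; rewrite lte_fin.
have tl : (t%:E < lambda_inf A gamma)%E by apply: lt_le_trans tk (enum_le_inf k).
have [/(resolvent_real ip_norm A_sa) [c c0 lowt]|st] := pselect (resolvent_set A t%:C).
  by exists c => // x dx _; exact: lowt.
have [_ [e e0 iso] _] := not_essential gt_ tl st.
have [|c c0 lowt] := @isolated_bounded_below _ _ _ ip_norm _ A_sa t e e0.
  move=> s s1 s2 /negP st'; apply/(resolvent_real ip_norm A_sa); apply: contrapT => ss.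
  apply: st'; apply/eqP; have /(congr1 (@complex.Re R)) // : s%:C = t%:C.
  apply: iso => //; rewrite -rmorphB normcR ltcR ltr_norml.
  by apply/andP; split; lra.
exists c => // x dx Kx; apply: lowt => // y dy Ay.
rewrite /realip; have [h1 h2 _] := hb t gt_ tl.
rewrite (h2 y x) // => j lj.
have jk : (j < k)%N.
  by rewrite ltnNge; apply/negP => kj; move: tk; rewrite -lj ltNge l_mono.
by have := Kx (Ordinal jk); rewrite /v /= lj tl.
Qed.

(** If the values stayed below mu, their supremum s would lie below the essential spectrum, hence be
    regular or isolated; the monotone sequence would become constant s, giving s infinitely many
    indices against its finite multiplicity. *)
Lemma enum_eventually_gt (mu : R) : gamma < mu -> (mu%:E < lambda_inf A gamma)%E ->
  exists k, (mu%:E < l k)%E.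
Proof.
move=> gm ml; apply: contrapT => no; have [l_mono l_val l_card] := l_enum.
have l_le k : (l k <= mu%:E)%E by rewrite leNgt; apply/negP => h; apply: no; exists k.
have real k : exists t, [/\ gamma < t, t <= mu, l k = t%:E & exists x, x != 0 /\ eig t%:C x].
  have [lk|[t [gt_ _ ext lk]]] := l_val k; first by have := l_le k; rewrite lk leNgt ml.
  by exists t; split=> //; rewrite -lee_fin -lk.
have [u hu] := choice real.
have u_mono i j : (i <= j)%N -> u i <= u j.
  by move=> /l_mono; have [_ _ -> _] := hu i; have [_ _ -> _] := hu j.
pose s := sup (range u).
have u_sup : has_sup (range u).
  by split; [exists (u 0%N), 0%N|exists mu => _ [k _ <-]; case: (hu k)].
have us k : u k <= s by apply: ub_le_sup; [exact: u_sup.2|exists k].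
have gs : gamma < s by apply: lt_le_trans (us 0%N); case: (hu 0%N).
have sm : s <= mu by apply: ge_sup; [exact: u_sup.1|move=> _ [k _ <-]; case: (hu k)].
have sl : (s%:E < lambda_inf A gamma)%E by apply: le_lt_trans ml; rewrite lee_fin.
have [e e0 iso] : exists2 e, 0 < e & forall k, `|u k - s| < e -> u k = s.
  have [/(resolvent_real ip_norm A_sa) [c c0 lows]|ss] := pselect (resolvent_set A s%:C).
    exists c => // k uk; have [_ _ _ [x [x0 ex]]] := hu k.
    by have := eigen_not_bounded_below x0 ex lows; rewrite leNgt uk.
  have [_ [e e0 iso] _] := not_essential gs sl ss; exists e => // k uk.
  have /(congr1 (@complex.Re R)) // : (u k)%:C = s%:C.
  apply: iso; last by rewrite -rmorphB normcR ltcR.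
  move=> /(resolvent_real ip_norm A_sa) [c c0 lowu]; have [_ _ _ [x [x0 ex]]] := hu k.
  by have := eigen_not_bounded_below x0 ex lowu; rewrite subrr normr0 leNgt c0.
have [_ [k0 _ <-] uk0] := sup_adherent e0 u_sup.
have eventually k : (k0 <= k)%N -> l k = s%:E.
  move=> k0k; have [_ _ -> _] := hu k; rewrite iso // ltr_norml.
  by have := u_mono _ _ k0k; have := us k; move: uk0; rewrite -/s => *; apply/andP; split; lra.
have [n [_ /card_set_bijP[f [f_homo f_inj _]]]] := l_card s gs sl.
(* Pigeonhole: f would map n + 1 indices injectively below n. *)
have : (size (map f (iota k0 n.+1)) <= size (iota 0 n))%N.
  apply: uniq_leq_size.
    rewrite map_inj_in_uniq ?iota_uniq // => i j; rewrite !mem_iota => /andP[i0 _] /andP[j0 _] fij.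
    by apply: f_inj => //; rewrite inE; exact: eventually.
  move=> _ /mapP[i + ->]; rewrite !mem_iota => /andP[i0 _] /=.
  by apply: f_homo; exact: eventually.
by rewrite size_map !size_iota ltnn.
Qed.

End Eigenvalues.

(** * Perturbation *)

Section Ereal.
Variable R : realType.
Local Open Scope ereal_scope.

Lemma real_between (a : R) (y : \bar R) : a%:E < y -> exists2 r, (a < r)%R & r%:E < y.
Proof.
case: y => [y| |]; rewrite ?lte_fin // => ay.
  by exists ((a + y) / 2)%R; rewrite ?lte_fin; lra.
by exists (a + 1)%R; rewrite ?ltry //; lra.
Qed.

Lemma half_ereal (b : R) (d : \bar R) : b%:E <= d * (2^-1)%:E -> (2 * b)%:E <= d.
Proof.
case: d => [d| |]; first by rewrite -EFinM !lee_fin; lra.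
  by rewrite leey.
by rewrite mulNyr gtr0_sg // mul1e leeNy_eq.
Qed.

Lemma lt_shift (b kappa : R) (x : \bar R) : b%:E < x + kappa%:E -> (b - kappa)%:E < x.
Proof. by rewrite EFinB lteBlDr. Qed.

End Ereal.

Section Perturbation.
Variables (R : realType) (H : completeNormedModType R[i]).
Variable ip : {dot H for Num.conj}.
Hypothesis ip_norm : forall x : H, ip x x = `|x| ^+ 2.
Variable A : operator H.
Hypothesis A_sa : self_adjoint ip A.
Variable B : {linear H -> H}.
Hypothesis B_bd : bounded_op B.
Hypothesis B_sym : symmetric_op ip B.
Variable gamma : R.
Hypothesis gamma_res : resolvent_set A gamma%:C.
Hypothesis B_small : (opnorm B <= dist_to gamma%:C (spectrum A) * (2^-1)%:E)%E.
Variables kappa E : R.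
Variable Q : set R -> {linear H -> H}.
Hypothesis Q_spec : spectral_measure ip (add_bounded A B) Q.
Hypothesis B_kappa : forall x : H, range (Q `]-oo, E]%classic) x ->
  kappa%:C * `|x| ^+ 2 <= ip x (B x).

Local Notation rip := (realip ip).
Local Notation M := (add_bounded A B).

Lemma add_sa : self_adjoint ip M.
Proof. by apply: sa_add => // a x y; exact: linearP. Qed.

Lemma opnorm_real : exists2 b, opnorm B = b%:E & 0 <= b.
Proof.
have n0 : (0%:E <= opnorm B)%E.
  by apply: ereal_sup_ubound; exists 0; rewrite /= ?raddf0 ?rnorm0.
have [K hK] := B_bd.
have : (opnorm B <= `|K|%:E)%E.
  apply: ge_ereal_sup => _ [x /= x1 <-]; rewrite lee_fin.
  apply: le_trans (hK x) _; apply: le_trans (_ : `|K| * rnorm x <= _).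
    by rewrite ler_wpM2r ?rnorm_ge0 // ler_norm.
  by rewrite -[leRHS]mulr1 ler_wpM2l.
by case: (opnorm B) n0 => [b| |] //; rewrite lee_fin => b0 _; exists b.
Qed.

Lemma opnorm_le b : opnorm B = b%:E -> forall x, rnorm (B x) <= b * rnorm x.
Proof.
move=> Bb x; have [->|x0] := eqVneq x 0; first by rewrite raddf0 rnorm0 mulr0.
have n0 := rnorm_gt0 x0.
have : ((rnorm (B ((rnorm x)^-1%:C *: x)))%:E <= opnorm B)%E.
  apply: ereal_sup_ubound; exists ((rnorm x)^-1%:C *: x) => //=.
  by rewrite rnormZR gtr0_norm ?invr_gt0 // mulVf ?gt_eqF.
rewrite Bb lee_fin linearZ_LR rnormZR gtr0_norm ?invr_gt0 // mulrC.
by rewrite ler_pdivrMr.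
Qed.

(** A - gamma is bounded below by 2 b, and subtracting B costs b. The same b bounds B and the gap,
    so the two cancel in the signs of the blocks of A. *)
Lemma gap_below_above : exists b,
  [/\ 0 <= b, forall x, rnorm (B x) <= b * rnorm x &
      forall z, dom A z -> b * rnorm z <= rnorm (shift M gamma z)].
Proof.
have [b Bb b0] := opnorm_real; exists b; have B_le := opnorm_le Bb.
split=> // z dz.
have low : 2 * b * rnorm z <= rnorm (shift A gamma z).
  by apply: (dist_low ip_norm A_sa) => //; apply: half_ereal; rewrite -Bb.
have : rnorm (shift A gamma z) <= rnorm (shift M gamma z) + rnorm (B z).
  rewrite -(rnormN (B z)); apply: le_trans (rnormD _ _).
  by rewrite !shiftE /= addrAC addrK.
by have := B_le z; lra.
Qed.

Lemma form_B b x : (forall x, rnorm (B x) <= b * rnorm x) -> `|rip (B x) x| <= b * rip x x.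
Proof.
move=> B_le; apply: le_trans (rip_le_norm ip_norm _ _) _.
by rewrite (ripxx ip_norm) expr2 mulrA ler_wpM2r ?rnorm_ge0.
Qed.

Lemma no_spectral_subspace k (l : nat -> \bar R) (lambda mu : R) (w : 'I_k.+1 -> H) :
  eigenvalue_enumeration A gamma l -> gamma < mu -> (mu%:E < l k)%E ->
  gamma < lambda -> lambda <= E -> lambda - kappa < mu ->
  lin_indep w -> (forall i, Q `]gamma, lambda] (w i) = w i) -> False.
Proof.
move=> l_enum gm mk gl lE lm w_indep Qw; have M_sa := add_sa.
have mitv (i : interval R) : measurable [set` i] by exact: measurable_itv.
have [b [b0 B_le low]] := gap_below_above.
have [v [gap onto]] := complement_gap ip_norm A_sa l_enum gamma_res gm mk.
pose P := Q `]-oo, gamma].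
have dw i : dom A (w i).
  apply: (dom_bounded ip_norm Q_spec (mitv `]gamma, lambda])
            (C := `|gamma| + `|lambda|) _ _ (Qw i)).
    by rewrite addr_ge0.
  move=> t /=; rewrite in_itv /= => /andP[t1 t2]; rewrite ler_norml.
  have := ler_norm (- gamma); have := ler_norm lambda; rewrite normrN.
  by have := normr_ge0 gamma; have := normr_ge0 lambda; move=> *; apply/andP; split; lra.
have disj : [set` `]-oo, gamma]] `&` [set` `]gamma, lambda]] = set0 :> set R.
  by apply/seteqP; split=> // t; rewrite /= !in_itv /= => -[] ? /andP[]; lra.
have above z : P z = 0 -> Q `]gamma, +oo[ z = z.
  move=> Pz; rewrite [RHS](Q_split ip_norm Q_spec z (mitv `]-oo, gamma])) -/P Pz add0r.
  congr (Q _ z); apply/seteqP; split=> t; rewrite /= !in_itv /= andbT.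
    by move=> h; apply/negP; rewrite -ltNge.
  by move/negP; rewrite -ltNge.
apply: (@subspace_contradiction _ _ _ ip_norm A A_sa B P B_sym _ _ _ gamma mu gm _ _ _
          k v w (lambda - kappa) lm gap onto w_indep dw).
- split=> [x|x y]; first exact: (QQ Q_spec).
  by case: Q_spec => -[proj _ _] _; case: (proj _ (mitv `]-oo, gamma])).
- by move=> x dx; exact: (dom_Q ip_norm Q_spec (mitv _) dx).
- by move=> x dx; exact: (Q_comm ip_norm M_sa Q_spec (mitv _) dx).
- move=> z dz Pz; have := form_below ip_norm M_sa Q_spec b0 low dz Pz.
  have := form_B z B_le; rewrite ler_norml => /andP[h _]; rewrite /= ripDl; lra.
- move=> z dz Pz; have := form_above ip_norm M_sa Q_spec b0 low dz (above z Pz).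
  have := form_B z B_le; rewrite ler_norml => /andP[_ h]; rewrite /= ripDl; lra.
- move=> z dz Pz; have := form_above ip_norm M_sa Q_spec b0 low dz (above z Pz).
  by have := mulr_ge0 b0 (rip_ge0 ip_norm z); rewrite mulrDl /=; lra.
- by move=> i; rewrite /P (Q_null ip_norm Q_spec (mitv `]gamma, lambda])) // setIC.
(* x lies in the spectral subspace of (-oo, lambda], also after adding z from ran P; so <(A + B) x,
   x> <= lambda |x|^2, and lambda <= E lets the hypothesis on B subtract kappa |x|^2. *)
move=> z c dz Pz /=; set x := _ + z.
have lin := sa_lin A_sa.
have dx : dom A x.
  by apply: (domD lin) => //; apply: (dom_sum lin) => i; exact: (domZ lin).
have QL y S : measurable S -> S `<=` `]-oo, lambda] -> Q S y = y -> Q `]-oo, lambda] y = y.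
  by move=> mS SL; exact: (Q_subset ip_norm Q_spec mS (mitv _) SL).
have Qx : Q `]-oo, lambda] x = x.
  rewrite /x raddfD raddf_sum /=; congr (_ + _).
    apply: eq_bigr => i _.
    rewrite -[in RHS](QL (w i) _ (mitv `]gamma, lambda]) _ (Qw i)).
      exact: linearZ_LR.
    by move=> t; rewrite /= !in_itv /= => /andP[].
  by apply: (QL z _ (mitv `]-oo, gamma])) => // t; rewrite /= !in_itv /=; lra.
have Mx : rip (M x) x <= lambda * rip x x.
  by apply: (form_le ip_norm Q_spec (mitv _) _ dx Qx) => t; rewrite /= in_itv.
have Bx : kappa * rip x x <= rip x (B x).
  have : range (Q `]-oo, E]%classic) x.
    exists x => //; apply: (Q_subset ip_norm Q_spec (mitv `]-oo, lambda]) (mitv _) _ Qx) => t.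
    by rewrite /= !in_itv /=; lra.
  move=> /B_kappa; rewrite -ip_norm /realip.
  have -> : ip x x = (rip x x)%:C by rewrite (ripxx ip_norm) ip_norm normE rmorphXn.
  by rewrite -rmorphM lecE => /andP[_].
by move: Mx; rewrite /= ripDl (ripC _ (B x)); lra.
Qed.

(** Common end of the cases of finite and infinite index. Vectors are requested for every lambda
    above b because the bottom of the essential spectrum may only be approached from above. *)
Lemma spectral_family_contradiction (l : nat -> \bar R) (b : R) k :
  eigenvalue_enumeration A gamma l -> gamma <= b -> b < E -> 
  (b%:E < l k + kappa%:E)%E ->
  (forall lambda, b < lambda -> exists w : 'I_k.+1 -> H,
     lin_indep w /\ forall i, Q `]gamma, lambda] (w i) = w i) -> False.
Proof.
move=> l_enum gb bE /lt_shift bk indep.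
have max_lt : ((Num.max (b - kappa) gamma)%:E < l k)%E.
  by have [_|_] := leP (b - kappa) gamma; [exact: (enum_gt ip_norm A_sa l_enum gamma_res)|].
have [mu mu_gt mk] := real_between max_lt.
move: mu_gt; rewrite gt_max => /andP[bm gm].
(* Below E for the hypothesis on B, and below mu + kappa so that lambda - kappa < mu. *)
pose lambda := (b + Num.min E (mu + kappa)) / 2.
have b_min : b < Num.min E (mu + kappa) by rewrite lt_min bE; lra.
have bl : b < lambda by rewrite /lambda; lra.
have l_min : lambda < Num.min E (mu + kappa) by rewrite /lambda; lra.
move: l_min; rewrite lt_min => /andP[lE lm].
have [w [w_indep Qw]] := indep _ bl.
by apply: (no_spectral_subspace l_enum gm mk _ _ _ w_indep Qw); lra.
Qed.

Lemma essential_family (b lambda : R) k : lambda_inf M gamma = b%:E ->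
  b < lambda -> exists w : 'I_k.+1 -> H,
     lin_indep w /\ forall i, Q `]gamma, lambda] (w i) = w i.
Proof.
move=> infE bl; have : (lambda_inf M gamma < lambda%:E)%E by rewrite infE lte_fin.
move=> /ereal_inf_lt[_ [t [gt_ ess_t] <-]]; rewrite lte_fin => tl.
exact: (essential_indep ip_norm add_sa Q_spec gt_ tl ess_t).
Qed.

End Perturbation.

Theorem theorem3p14 (R : realType) (H : completeNormedModType R[i])
    (ip : {dot H for Num.conj})
    (ip_norm : forall x : H, ip x x = `|x| ^+ 2)
    (H_inf : infinite_dimensional H)
    (A : operator H) (A_sa : self_adjoint ip A)
    (B : {linear H -> H}) (B_bd : bounded_op B) (B_sym : symmetric_op ip B)
    (gamma : R) (gamma_res : resolvent_set A gamma%:C)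
    (B_small : (opnorm B <= dist_to gamma%:C (spectrum A) * (2^-1)%:E)%E)
    (kappa E : R) (E_gt : gamma < E)
    (Q : set R -> {linear H -> H})
    (Q_spec : spectral_measure ip (add_bounded A B) Q)
    (B_kappa : forall x : H, range (Q `]-oo, E]%classic) x ->
       kappa%:C * `|x| ^+ 2 <= ip x (B x))
    (lA lAB : nat -> \bar R)
    (lA_enum : eigenvalue_enumeration A gamma lA)
    (lAB_enum : eigenvalue_enumeration (add_bounded A B) gamma lAB) :
  (forall k : nat, (lAB k < E%:E)%E -> (lAB k >= lA k + kappa%:E)%E) /\
  ((lambda_inf (add_bounded A B) gamma < E%:E)%E ->
   (lambda_inf (add_bounded A B) gamma >= lambda_inf A gamma + kappa%:E)%E).
Proof.
have M_sa := add_sa A_sa B_sym.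
have inf_ge := lambda_inf_ge (add_bounded A B) gamma.
split=> [k kE|infE]; rewrite leNgt; apply/negP => bad.
  have [b bk gb] : exists2 b, lAB k = b%:E & gamma <= b.
    have : (gamma%:E <= lAB k)%E.
      have [_ /(_ k) [->|[t [gt_ _ _ ->]]] _] := lAB_enum => //.
      by rewrite lee_fin ltW.
    by case: (lAB k) kE => [b| |] //; rewrite lee_fin => _ gb; exists b.
  rewrite bk in bad kE; rewrite lte_fin in kE.
  apply: (spectral_family_contradiction ip_norm A_sa B_bd B_sym gamma_res
            B_small Q_spec B_kappa lA_enum gb kE bad).
  (* A value filled in by [lambda_inf] takes its vectors from the essential spectrum, a genuine
     eigenvalue from the first k + 1 eigenvectors. *)
  move=> lambda bl; have [_ /(_ k) [kinf|[t [gt_ tl _ kt]]] _] := lAB_enum.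
    by apply: (essential_family ip_norm A_sa B_sym Q_spec k _ bl); rewrite -kinf.
  have [|w [w_indep w_eig]] := @eigenvectors_indep _ _ _ ip_norm _ M_sa _ _ lAB_enum k.
    by rewrite kt.
  exists w; split=> // i; have [s [gs sk ws]] := w_eig i.
  apply: (eigenvector_window ip_norm M_sa Q_spec gs _ ws).
  by move: sk; rewrite bk lee_fin => sb; exact: le_lt_trans sb bl.
have [b bE gb] : exists2 b, lambda_inf (add_bounded A B) gamma = b%:E & gamma <= b.
  by case: (lambda_inf _ _) infE inf_ge => [b| |] //; rewrite lee_fin => _ gb; exists b.
rewrite bE in bad infE; rewrite lte_fin in infE.
have max_lt : ((Num.max (b - kappa) gamma)%:E < lambda_inf A gamma)%E.
  have [_|_] := leP (b - kappa) gamma; last exact: lt_shift.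
  exact: (lambda_inf_gt ip_norm A_sa gamma_res).
have [mu mu_gt ml] := real_between max_lt.
move: mu_gt; rewrite gt_max => /andP[bm gm].
(* The infinite index reduces to a finite one: some k already has mu < lA k, and the essential
   spectrum of A + B supplies k + 1 independent vectors for any k. *)
have [k mk] := enum_eventually_gt ip_norm A_sa lA_enum gm ml.
apply: (spectral_family_contradiction ip_norm A_sa B_bd B_sym gamma_res
          B_small Q_spec B_kappa lA_enum gb infE (k := k)).
  rewrite -lteBlDr // -EFinB; apply: lt_trans mk; by rewrite lte_fin.
by move=> lambda bl; exact: (essential_family ip_norm A_sa B_sym Q_spec k bE bl).
Qed.
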